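(* Consider the finite-horizon optimal control problem $$\inf_{u_0,\dots,u_{T-1}} \mathbb{E}\Big[x_T^\top Q_T x_T+\sum_{t=0}^{T-1}\big(x_t^\top Q x_t+u_t^\top R u_t\big)\Big]$$ over admissible policies $u_t=\mu_t(\mathcal I_t)$, subject to the linear dynamics with bilinear observations $$x_{t+1}=Ax_t+Bu_t+w_t,\qquad y_t=\Big(C_0+\sum_{k=1}^p (u_t)_k C_k\Big)x_t+z_t ,$$ with Gaussian noise and Gaussian initial state, and with $Q_T,Q,R\succ 0$ (see the context). Let $T\ge 2$, and let $\{u_k^\star=\mu_k^\star(\mathcal I_k)\}_{k=0}^{T-1}$ be an optimal control policy. Then, for $k\le T-2$, the optimal control policy $\mu_k^\star(\mathcal I_k)$ is in general not affine in the estimated state $\mathbb{E}[x_k\mid\mathcal I_k]$. That is, for every $T\ge 2$ and every $0\le k\le T-2$ there exist problem data $(A,B,C_0,\dots,C_p,Q_T,Q,R,\Sigma_w,\Sigma_z)$ satisfying the assumptions in the context for which the optimal policy at time $k$ is not affine in the estimated state, in the sense defined in the context.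
   Context: Dimensions: $x_t\in\mathbb{R}^n$ (state), $u_t\in\mathbb{R}^p$ (input), $y_t\in\mathbb{R}^m$ (output), $A\in\mathbb{R}^{n\times n}$, $B\in\mathbb{R}^{n\times p}$, $C_0,\dots,C_p\in\mathbb{R}^{m\times n}$; $(u_t)_k$ is the $k$-th entry of $u_t$. All these matrices and the cost matrices are known. Assumptions: the process noise $\{w_t\}_{t=0}^{T-1}$ is i.i.d. $\mathcal N(0,\Sigma_w)$, the measurement noise $\{z_t\}_{t=0}^{T-1}$ is i.i.d. $\mathcal N(0,\Sigma_z)$ with $\Sigma_z$ invertible, $x_0\sim\mathcal N(\hat x_0,\Sigma_0)$ with $\Sigma_0$ invertible; $x_0$, $\{w_t\}$, $\{z_t\}$ are mutually independent; and $Q_T,Q,R$ are symmetric positive definite. Information and admissibility: $\mathcal I_0=\emptyset$ and $\mathcal I_{t}=\{u_0,\dots,u_{t-1},y_0,\dots,y_{t-1}\}$, so $\mathcal I_{t+1}=\{\mathcal I_t,u_t,y_t\}$ (note that $y_t\notin\mathcal I_t$). A policy is admissible if $u_t=\mu_t(\mathcal I_t)$ for every $t$. Sufficient statistics: under these assumptions $x_t\mid\mathcal I_t\sim\mathcal N(\hat x_{t|t-1},\Sigma_{t|t-1})$, where $\hat x_{t|t-1}=\mathbb{E}[x_t\mid\mathcal I_t]$ is the estimated state and $\Sigma_{t|t-1}$ is the (input-dependent) error covariance, and the pair $(\hat x_{t|t-1},\Sigma_{t|t-1})$ is a sufficient statistic for the optimal policy at time $t$. Meaning of ''affine in the estimated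 state'': for $\hat x\in\mathbb{R}^n$ and symmetric positive definite $\Sigma$, let $U_k^\star(\hat x,\Sigma)\subset\mathbb{R}^p$ be the set of optimal first actions $u_k$ for the tail problem of minimizing $\mathbb{E}\big[x_T^\top Q_Tx_T+\sum_{t=k}^{T-1}(x_t^\top Qx_t+u_t^\top Ru_t)\big]$ over admissible policies from time $k$ onward when $x_k\sim\mathcal N(\hat x,\Sigma)$ (that is, conditionally on information $\mathcal I_k$ yielding these statistics). The optimal policy at time $k$ is affine in the estimated state if for every $\Sigma\succ0$ there exist a matrix $L\in\mathbb{R}^{p\times n}$ and a vector $d\in\mathbb{R}^p$ (not depending on $\hat x$) such that $L\hat x+d\in U_k^\star(\hat x,\Sigma)$ for all $\hat x\in\mathbb{R}^n$. *)

(* Defs.v *)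
From HB Require Import structures.
From mathcomp Require Import all_boot all_order all_algebra.
From mathcomp Require Import all_classical all_reals all_analysis.

Set Implicit Arguments.
Unset Strict Implicit.
Unset Printing Implicit Defensive.

Import Order.TTheory GRing.Theory Num.Theory.
Import numFieldNormedType.Exports.

Local Open Scope classical_set_scope.
Local Open Scope ring_scope.

(* 'M[R]_(m, n) carries the sigma-algebra generated by its entries, which is
   the Borel sigma-algebra of the finite-dimensional space R^(m * n). *)
Section measurable_matrix.
Context {R : realType} {m n : nat}.

Definition entry_cylinders : set (set 'M[R]_(m, n)) :=
  [set E | exists (i : 'I_m) (j : 'I_n) (S : set R),
    measurable S /\ E = [set M : 'M[R]_(m, n) | S (M i j)]].

Let mx_set0 : <<s entry_cylinders >> set0.
Proof. exact: sigma_algebra0. Qed.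

Let mx_setC A : <<s entry_cylinders >> A -> <<s entry_cylinders >> (~` A).
Proof. exact: sigma_algebraC. Qed.

Let mx_bigcup (F : (set 'M[R]_(m, n))^nat) :
  (forall i, <<s entry_cylinders >> (F i)) ->
  <<s entry_cylinders >> (\bigcup_i F i).
Proof. exact: sigma_algebra_bigcup. Qed.

HB.instance Definition _ :=
  @isMeasurable.Build (sigma_display entry_cylinders) 'M[R]_(m, n)
    <<s entry_cylinders >> mx_set0 mx_setC mx_bigcup.

End measurable_matrix.

Section quadratic_forms.
Context {R : realType} {n : nat}.
Implicit Types (M : 'M[R]_n) (v : 'cV[R]_n).

Definition qform M v : R := (v^T *m M *m v) 0 0.

Definition posdef M : Prop := M^T = M /\ forall v, v != 0 -> 0 < qform M v.

Definition possemidef M : Prop := M^T = M /\ forall v, 0 <= qform M v.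

End quadratic_forms.

Section gaussian_vectors.
Context {R : realType}.

(* [normal_prob mu 0] is a junk value (uniform on [0, 1]), hence the case
   split: the normal law with variance 0 is a point mass. *)
Definition normal_law (mu var : R) (S : set R) : \bar R :=
  if var == 0 then \d_mu S else normal_prob mu (Num.sqrt var) S.

(* N(mu, Sigma), Sigma possibly singular: every linear form of X is normal. *)
Definition is_gaussian (d : measure_display) (Om : measurableType d)
    (P : probability Om R) (n : nat) (X : {RV P >-> 'cV[R]_n})
    (mu : 'cV[R]_n) (Sigma : 'M[R]_n) : Prop :=
  forall (a : 'cV[R]_n) (S : set R), measurable S ->
    P [set om | S ((a^T *m X om) 0 0)] =
    normal_law ((a^T *m mu) 0 0) (qform Sigma a) S.

End gaussian_vectors.

Record plant (R : realType) (n p m : nat) := Plant {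
  dynA : 'M[R]_n;
  dynB : 'M[R]_(n, p);
  obsC0 : 'M[R]_(m, n);
  obsC : 'I_p -> 'M[R]_(m, n);
  costQT : 'M[R]_n;
  costQ : 'M[R]_n;
  costR : 'M[R]_p;
  covw : 'M[R]_n;
  covz : 'M[R]_m
}.

Section control_problem.
Context {R : realType} {n p m : nat}.
Variable D : plant R n p m.

Definition standing_assumptions : Prop :=
  [/\ [/\ posdef (costQT D), posdef (costQ D) & posdef (costR D)],
      possemidef (covw D), possemidef (covz D) & covz D \in unitmx].

Definition obs_matrix (u : 'cV[R]_p) : 'M[R]_(m, n) :=
  obsC0 D + \sum_(i < p) u i 0 *: obsC D i.

(* Primitive randomness of the problem started at time k. The conditioning on
   I_k enters only through the law N(xhat, Sigma) of x_k. The last clause is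
   the mutual independence of x_k, w_k, ..., w_(T-1), z_k, ..., z_(T-1). *)
Record noise_model (T k : nat) (xhat : 'cV[R]_n) (Sigma : 'M[R]_n)
    (d : measure_display) (Om : measurableType d) (P : probability Om R) :=
  NoiseModel {
  init : {RV P >-> 'cV[R]_n};
  wnoise : nat -> {RV P >-> 'cV[R]_n};
  znoise : nat -> {RV P >-> 'cV[R]_m};
  init_gaussian : is_gaussian init xhat Sigma;
  wnoise_gaussian : forall t, (k <= t < T)%N ->
    is_gaussian (wnoise t) 0 (covw D);
  znoise_gaussian : forall t, (k <= t < T)%N ->
    is_gaussian (znoise t) 0 (covz D);
  noise_independent :
    forall (E : set 'cV[R]_n) (F : nat -> set 'cV[R]_n)
           (G : nat -> set 'cV[R]_m),
    measurable E -> (forall t, measurable (F t)) ->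
    (forall t, measurable (G t)) ->
    P (init @^-1` E `&`
       \bigcap_(t in [set t | (k <= t < T)%N])
         (wnoise t @^-1` F t `&` znoise t @^-1` G t)) =
    (P (init @^-1` E) *
     \prod_(k <= t < T)
       (P (wnoise t @^-1` F t) * P (znoise t @^-1` G t)))%E
}.

(* What the controller has seen between times k and k + j:
   [:: (u_k, y_k); ...; (u_(k+j-1), y_(k+j-1))]. *)
Definition history (j : nat) := j.-tuple ('cV[R]_p * 'cV[R]_m)%type.

(* [pi j] gives u_(k+j); y_(k+j) is not available when it is chosen. *)
Definition policy := forall j : nat, history j -> 'cV[R]_p.

Definition admissible (pi : policy) : Prop :=
  forall j, measurable_fun [set: history j] (pi j).

Definition first_action (pi : policy) : 'cV[R]_p := pi 0%N [tuple].

Section closed_loop.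
Context {T k : nat} {xhat : 'cV[R]_n} {Sigma : 'M[R]_n}.
Context {d : measure_display} {Om : measurableType d} {P : probability Om R}.
Variables (N : noise_model T k xhat Sigma P) (pi : policy).

(* (x_(k+j), history at time k+j) *)
Fixpoint trajectory (om : Om) (j : nat) : 'cV[R]_n * history j :=
  match j with
  | 0 => (init N om, [tuple])
  | i.+1 =>
    let: (x, h) := trajectory om i in
    let u := pi h in
    let y := obs_matrix u *m x + znoise N (k + i) om in
    (dynA D *m x + dynB D *m u + wnoise N (k + i) om,
     [tuple of rcons h (u, y)])
  end.

Definition state (om : Om) (j : nat) : 'cV[R]_n := (trajectory om j).1.

Definition input (om : Om) (j : nat) : 'cV[R]_p := pi (trajectory om j).2.

Definition expected_cost : \bar R :=
  \int[P]_om (qform (costQT D) (state om (T - k)) +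
    \sum_(j < T - k) (qform (costQ D) (state om j) +
                      qform (costR D) (input om j)))%:E.

End closed_loop.

(* The expected cost depends only on the law of the noise model, so optimality
   is required on every probability space carrying one. *)
Definition optimal_policy (T k : nat) (xhat : 'cV[R]_n) (Sigma : 'M[R]_n)
    (pi : policy) : Prop :=
  admissible pi /\
  forall (d : measure_display) (Om : measurableType d) (P : probability Om R)
    (N : noise_model T k xhat Sigma P) (pi' : policy),
    admissible pi' -> (expected_cost N pi <= expected_cost N pi')%E.

(* U_k^*(xhat, Sigma) *)
Definition optimal_first_actions (T k : nat) (xhat : 'cV[R]_n)
    (Sigma : 'M[R]_n) : set 'cV[R]_p :=
  [set u | exists2 pi, optimal_policy T k xhat Sigma pi & first_action pi = u].

Definition affine_in_estimate (T k : nat) : Prop :=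
  forall Sigma : 'M[R]_n, posdef Sigma ->
    exists (L : 'M[R]_(p, n)) (b : 'cV[R]_p), forall xhat : 'cV[R]_n,
      optimal_first_actions T k xhat Sigma (L *m xhat + b).

Definition has_optimal_policies (T : nat) : Prop :=
  forall (k : nat) (xhat : 'cV[R]_n) (Sigma : 'M[R]_n),
    (k < T)%N -> posdef Sigma ->
    exists pi, optimal_policy T k xhat Sigma pi.

End control_problem.

(* Main.v *)
From HB Require Import structures.
Require Import Defs.
From mathcomp Require Import all_boot all_order all_algebra.
From mathcomp Require Import all_classical all_reals all_analysis.
From mathcomp Require Import measurable_realfun ring lra.

Set Implicit Arguments.
Unset Strict Implicit.
Unset Printing Implicit Defensive.

Import Order.TTheory GRing.Theory Num.Theory.
Import numFieldNormedType.Exports.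

Local Open Scope classical_set_scope.
Local Open Scope ring_scope.

(** The counterexample has three states, one input and one output:
<<
      x_(t+1) = (x_t2 + u_t, x_t3, 0),      y_t = u_t * x_t3 + z_t,
>>
    with identity cost matrices, no process noise and unit measurement noise.
    The input is at once actuator and sensor gain: the unknown third
    coordinate is observed only through u_t * x_t3, so a larger input buys a
    better measurement.

    Because the shift is nilpotent, the initial state (a, b, c) is forgotten
    after three steps: the states are (a, b, c), (b + u_0, c, 0),
    (c + u_1, 0, 0), (u_2, 0, 0), (u_3, 0, 0), and so on.  Hence every horizon
    reduces to two decisions.  All inputs from u_2 on should vanish, u_1
    should compensate c as well as y_0 = u_0 c + z_0 allows, and u_0 = v trades
    the displacement (b + v)^2 + v^2 against the quality of the measurement.
    With c ~ N(m, s2) and unit noise, c is given y_0 Gaussian with a mean that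
    is affine in y_0 and with the deterministic variance s2 / (s2 v^2 + 1)
    ([normal_bayes], a completed square followed by Tonelli).  The best
    correction is minus half the posterior mean, and its cost is known exactly
    ([min_correction_cost_le], [min_correction_cost_eq]).  So the optimal cost
    with first action v is, up to a constant,
<<
      2 v^2 + 2 b v + K / (s2 v^2 + 1)      (b the mean of the second state),
>>
    with K > 0 as soon as two decisions remain and K = 0 otherwise
    ([expected_cost_ge], [expected_cost_eq], [sensing_costE]).  This function
    is continuous and coercive, so optimal policies exist for every horizon
    and every prior.  If the optimal first action were affine in the estimate,
    then, for s2 = 1, the stationarity equation
    4 v + 2 b = 2 K v / (v^2 + 1)^2 would hold along v = L b + d for every real
    b, and the rational function on the right would be affine, which three
    values refute ([stationary_not_affine]).

    Optimality is a statement about every probability space that carries the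
    noises, so deducing anything from it requires such a space to exist:
    [ex_noise_model] builds one from products of normal laws.  Measurability
    of the closed loop under an arbitrary admissible policy
    ([measurable_trajectory]) is what allows the cost of every competitor to be
    bounded below. *)

(** * Affine changes of variables *)

(** The measure structure of [pushforward] depends on a proof of measurability;
    the existential hides it. *)
Lemma ex_image_measure d d' (T : measurableType d) (T' : measurableType d')
    (R : realFieldType) (m : {measure set T -> \bar R})
    (f : T -> T') :
  measurable_fun setT f ->
  exists im : {measure set T' -> \bar R}, im = pushforward m f :> (set T' -> _).
Proof. by move=> mf; unshelve eexists; [exact: (pushforward m f)|]. Qed.

Section lebesgue_affine.
Context {R : realType}.
Local Open Scope ereal_scope.
Local Notation mu := (@lebesgue_measure R).
Implicit Types (f : R -> \bar R) (s t : R).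

Lemma ge0_integral_affine_pos f s t : (0 < s)%R ->
  measurable_fun [set: R] f -> (forall x, 0 <= f x) ->
  \int[mu]_x f x = s%:E * \int[mu]_x f (s * x + t)%R.
Proof.
move=> s0 mf f0.
pose phi : R -> measurableTypeR R := fun x => (s * x + t)%R.
have mphi : measurable_fun setT phi.
  by apply: measurable_funD => //; exact: measurable_funM.
pose k : {nonneg R} := NngNum (ltW s0).
have [im imE] := ex_image_measure mu mphi.
pose nu := mscale k im.
have munu A : measurable A -> mu A = nu A.
  apply: lebesgue_measure_unique => _ [[a b] /= _ <-].
  rewrite /nu/= /mscale/= imE /pushforward.
  have -> : phi @^-1` `]a, b] = `]((a - t) / s)%R, ((b - t) / s)%R]%classic.
    apply/seteqP; split => x /=; rewrite !in_itv/= /phi.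
      by rewrite ltr_pdivrMr// ler_pdivlMr// mulrC ltrBlDr lerBrDr.
    by rewrite ltr_pdivrMr// ler_pdivlMr// mulrC ltrBlDr lerBrDr.
  rewrite lebesgue_measure_itv/= lte_fin.
  rewrite [X in _ = _ * X]lebesgue_measure_itv/= lte_fin.
  rewrite ltr_pM2r ?invr_gt0// ltrD2r.
  case: ifPn => // _; last by rewrite mule0.
  by rewrite -EFinD -EFinM; congr EFin; field; rewrite gt_eqF.
transitivity (\int[nu : {measure set (measurableTypeR R) -> \bar R}]_x f x).
  by apply: eq_measure_integral => A mA _; exact: munu.
rewrite /nu ge0_integral_mscale//=; congr (_ * _).
by rewrite imE ge0_integral_pushforward.
Qed.

Lemma ge0_integral_opp f :
  measurable_fun [set: R] f -> (forall x, 0 <= f x) ->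
  \int[mu]_x f x = \int[mu]_x f (- x)%R.
Proof.
move=> mf f0.
transitivity (\int[pushforward mu (-%R : _ -> measurableTypeR R)]_x f x).
  by apply: eq_measure_integral => A mA _; exact/esym/lebesgue_measureN.
by rewrite ge0_integral_pushforward.
Qed.

(** The image of Lebesgue measure under x |-> s x + t, rescaled by |s|, agrees
    with Lebesgue measure on intervals; a negative s costs one reflection. *)
Lemma ge0_integral_affine f s t : s != 0%R ->
  measurable_fun [set: R] f -> (forall x, 0 <= f x) ->
  \int[mu]_x f x = `|s|%:E * \int[mu]_x f (s * x + t)%R.
Proof.
move=> s0 mf f0; have := s0; rewrite neq_lt => /orP[sN|sP]; last first.
  by rewrite gtr0_norm//; exact: ge0_integral_affine_pos.
rewrite ltr0_norm// (@ge0_integral_affine_pos f (- s) t) ?oppr_gt0//.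
congr (_ * _); rewrite ge0_integral_opp//; last first.
  by apply: measurableT_comp => //; exact: measurable_funD.
by under eq_integral do rewrite mulrNN.
Qed.

End lebesgue_affine.

Section normal_integral.
Context {R : realType}.
Local Open Scope ereal_scope.
Local Notation mu := (@lebesgue_measure R).
Implicit Types (f : R -> \bar R) (m s t : R).

(** The normal density is a Radon-Nikodym derivative of [normal_prob], so the
    general change of measure applies. *)
Lemma ge0_integral_normal_prob m s f :
  measurable_fun [set: R] f -> (forall x, 0 <= f x) ->
  \int[normal_prob m s]_x f x = \int[mu]_x (f x * (normal_pdf m s x)%:E).
Proof.
move=> mf f0.
rewrite -(Radon_Nikodym_SigmaFinite.change_of_variables
  (normal_prob_dominates m s) f0 measurableT mf).
have dom := normal_prob_dominates m s.
have intRN := Radon_Nikodym_SigmaFinite.f_integrable dom.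
apply: ae_eq_integral => //=.
- by apply: emeasurable_funM => //; exact: measurable_int intRN.
- apply: emeasurable_funM => //; apply/measurable_EFinP.
  exact: measurable_normal_pdf.
- apply: ae_eqe_mul2l; apply: integral_ae_eq => //.
  + by apply/measurable_EFinP; exact: measurable_normal_pdf.
  + by move=> A _ mA; rewrite -Radon_Nikodym_SigmaFinite.f_integral.
Qed.

(** Densities see the standard deviation only through its square, so a negative
    value is harmless; this lets an affine map with negative slope act on normal
    laws without absolute values. *)
Lemma normal_prob_sqr m s t : s != 0%R -> t != 0%R ->
  (s ^+ 2 = t ^+ 2)%R -> normal_prob m s = normal_prob m t.
Proof.
move=> s0 t0 st; apply/funext => A; rewrite /normal_prob.
by apply: eq_integral => x _; rewrite !normal_pdfE// /normal_peak /normal_fun st.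
Qed.

Lemma normal_pdf_affine m s a t x : a != 0%R -> s != 0%R ->
  (normal_pdf m s x = `|a| * normal_pdf (a * m + t) (a * s) (a * x + t))%R.
Proof.
move=> a0 s0; rewrite !normal_pdfE ?mulf_neq0// mulrA; congr (_ * _)%R.
  rewrite /normal_peak.
  have -> : ((a * s) ^+ 2 * pi *+ 2 = a ^+ 2 * (s ^+ 2 * pi *+ 2))%R by ring.
  by rewrite sqrtrM ?sqr_ge0// sqrtr_sqr invfM mulrA divff ?mul1r// normr_eq0.
rewrite /normal_fun; congr expR; field.
by rewrite a0 s0.
Qed.

Lemma ge0_integral_normal_affine m s a t f : a != 0%R -> s != 0%R ->
  measurable_fun [set: R] f -> (forall x, 0 <= f x) ->
  \int[normal_prob (a * m + t) (a * s)]_x f x =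
  \int[normal_prob m s]_x f (a * x + t)%R.
Proof.
move=> a0 s0 mf f0.
have maff : measurable_fun [set: R] (fun x => a * x + t)%R.
  by apply: measurable_funD => //; exact: measurable_funM.
have mpdf : measurable_fun [set: R]
    (fun x => (normal_pdf (a * m + t) (a * s) x)%:E).
  by apply/measurable_EFinP; exact: measurable_normal_pdf.
have mfaff : measurable_fun [set: R] (fun x => f (a * x + t)%R).
  exact: measurableT_comp mf maff.
rewrite (ge0_integral_normal_prob _ _ mf f0).
rewrite (ge0_integral_normal_prob m s mfaff (fun=> f0 _)).
have pdf0 x : 0 <= (normal_pdf (a * m + t) (a * s) x)%:E.
  by rewrite lee_fin normal_pdf_ge0.
rewrite (@ge0_integral_affine _ _ a t a0)//; last 2 first.
- exact: emeasurable_funM.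
- by move=> x; rewrite mule_ge0.
rewrite -ge0_integralZl//; first last.
- by move=> x _; rewrite mule_ge0.
- exact: (emeasurable_funM mfaff (measurableT_comp mpdf maff)).
apply: eq_integral => x _.
by rewrite (@normal_pdf_affine m s a t)// EFinM muleCA muleA.
Qed.

Lemma normal_prob_affine m s a t (S : set R) : a != 0%R -> s != 0%R ->
  measurable S ->
  normal_prob (a * m + t) (a * s) S = normal_prob m s [set x | S (a * x + t)%R].
Proof.
move=> a0 s0 mS.
have maff : measurable_fun [set: R] (fun x => a * x + t)%R.
  by apply: measurable_funD => //; exact: measurable_funM.
have mS' : measurable [set x | S (a * x + t)%R].
  by rewrite -[X in measurable X]setTI; exact: maff.
transitivity (\int[normal_prob (a * m + t) (a * s)]_x (\1_S x)%:E).
  by rewrite integral_indic// setIT.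
rewrite ge0_integral_normal_affine//; last exact/measurable_EFinP.
transitivity (\int[normal_prob m s]_x (\1_[set x | S (a * x + t)%R] x)%:E).
  by apply: eq_integral => x _; rewrite !indicE.
by rewrite integral_indic// setIT.
Qed.

End normal_integral.

(** * Bayes' rule for a normal variable observed in normal noise *)

Section normal_bayes.
Context {R : realType}.
Local Notation mu := (@lebesgue_measure R).
Implicit Types (m s t v x y z c : R).

(** The mean of c given v c + z = y, for independent c ~ N(m, s^2) and
    z ~ N(0, 1). *)
Definition posterior_mean m s v y : R :=
  m + s ^+ 2 * v / (s ^+ 2 * v ^+ 2 + 1) * (y - v * m).

Lemma measurable_posterior_mean m s v :
  measurable_fun [set: R] (posterior_mean m s v).
Proof.
apply: measurable_funD => //; apply: measurable_funM => //.
exact: measurable_funB.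
Qed.

Lemma normal_pdf_center m s x : s != 0 -> normal_pdf m s x = normal_pdf 0 s (x - m).
Proof. by move=> s0; rewrite !normal_pdfE// normal_fun_center. Qed.

(** Prior times likelihood is evidence times posterior: complete the square in
    c.  The normalising constants match because s * 1 = t * (s / t). *)
Lemma normal_pdf_bayes m s t v c y : s != 0 -> t != 0 ->
  t ^+ 2 = s ^+ 2 * v ^+ 2 + 1 ->
  normal_pdf m s c * normal_pdf (v * c) 1 y =
  normal_pdf (v * m) t y * normal_pdf (posterior_mean m s v y) (s / t) c.
Proof.
move=> s0 t0 t2; rewrite !normal_pdfE ?oner_eq0 ?mulf_neq0 ?invr_eq0//.
rewrite mulrACA [RHS]mulrACA; congr (_ * _).
  rewrite /normal_peak -!invfM -!sqrtrM; try by
    rewrite mulrn_wge0// mulr_ge0 ?sqr_ge0 ?pi_ge0.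
  have -> : s ^+ 2 * pi *+ 2 * (1 ^+ 2 * pi *+ 2) =
    t ^+ 2 * pi *+ 2 * ((s / t) ^+ 2 * pi *+ 2) :> R by field.
  by [].
have d0 : s ^+ 2 * v ^+ 2 + 1 != 0 by rewrite -t2 expf_neq0.
rewrite /normal_fun -!expRD expr_div_n t2 /posterior_mean; congr expR.
by field; rewrite exprMn d0 s0.
Qed.

Local Open Scope ereal_scope.

(** Disintegration of the joint law of (c, v c + z): pass to densities, shift the
    inner variable by v c, exchange the integrals and use [normal_pdf_bayes].
    Restricting to nonnegative integrands avoids every integrability condition,
    which matters since the actions of an arbitrary policy need not be square
    integrable. *)
Lemma normal_bayes m s t v (h : R * R -> \bar R) : s != 0%R -> t != 0%R ->
  (t ^+ 2 = s ^+ 2 * v ^+ 2 + 1)%R ->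
  measurable_fun setT h -> (forall p, 0 <= h p) ->
  \int[normal_prob m s]_c \int[normal_prob 0 1]_z h (c, (v * c + z)%R) =
  \int[normal_prob (v * m) t]_y
    \int[normal_prob (posterior_mean m s v y) (s / t)]_c h (c, y).
Proof.
move=> s0 t0 t2 mh h0.
have mpdf m' s' : measurable_fun [set: R] (fun x => (normal_pdf m' s' x)%:E).
  by apply/measurable_EFinP; exact: measurable_normal_pdf.
have pdf0 m' s' x : 0 <= (normal_pdf m' s' x)%:E.
  by rewrite lee_fin normal_pdf_ge0.
have st0 : (s / t)%R != 0%R by rewrite mulf_neq0// invr_eq0.
have mh1 c : measurable_fun [set: R] (fun y => h (c, y)).
  by apply: measurableT_comp mh _; exact: pair1_measurable.
have mh2 y : measurable_fun [set: R] (fun c => h (c, y)).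
  by apply: measurableT_comp mh _; exact: pair2_measurable.
pose g (p : R * R) := h p * (normal_pdf (v * p.1) 1 p.2)%:E.
have gE (p : R * R) : g p = h p * (normal_pdf 0 1 (p.2 - v * p.1))%:E.
  by rewrite /g normal_pdf_center ?oner_eq0.
have mg : measurable_fun setT g.
  rewrite (funext gE); apply: emeasurable_funM => //.
  apply: measurableT_comp (mpdf 0 1)%R _ => //.
  apply: measurable_funB => //; exact: measurable_funM.
have g0 p : 0 <= g p by rewrite mule_ge0.
pose k (p : R * R) :=
  h p * (normal_pdf (posterior_mean m s v p.2) (s / t) p.1)%:E.
have kE (p : R * R) :
    k p = h p * (normal_pdf 0 (s / t) (p.1 - posterior_mean m s v p.2))%:E.
  by rewrite /k normal_pdf_center.
have mk : measurable_fun setT k.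
  rewrite (funext kE); apply: emeasurable_funM => //.
  apply: measurableT_comp (mpdf 0 (s / t))%R _ => //.
  apply: measurable_funB => //.
  exact: measurableT_comp (measurable_posterior_mean m s v) _.
have k0 p : 0 <= k p by rewrite mule_ge0.
have inner1 c : \int[normal_prob 0 1]_z h (c, (v * c + z)%R) =
                \int[mu]_y g (c, y).
  have := @ge0_integral_normal_affine R 0%R 1%R 1%R (v * c)%R (fun y => h (c, y))
    (oner_neq0 _) (oner_neq0 _) (mh1 c) (fun=> h0 _).
  rewrite mulr0 mulr1 add0r => e.
  transitivity (\int[normal_prob (v * c) 1]_y h (c, y)).
    by rewrite e; apply: eq_integral => z _; rewrite mul1r addrC.
  by rewrite (ge0_integral_normal_prob _ _ (mh1 c) (fun=> h0 _)).
have inner2 y : \int[normal_prob (posterior_mean m s v y) (s / t)]_c h (c, y) =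
                \int[mu]_c k (c, y).
  by rewrite (ge0_integral_normal_prob _ _ (mh2 y) (fun=> h0 _)).
have mG : measurable_fun setT (fun c => \int[mu]_y g (c, y)).
  exact: (@measurable_fun_fubini_tonelli_F _ _ _ _ R mu g mg g0).
have mK : measurable_fun setT (fun y => \int[mu]_c k (c, y)).
  exact: (@measurable_fun_fubini_tonelli_G _ _ _ _ R mu k mk k0).
under eq_integral do rewrite inner1.
under [RHS]eq_integral do rewrite inner2.
rewrite (ge0_integral_normal_prob m s mG); last first.
  by move=> c; apply: integral_ge0 => y _; exact: g0.
rewrite (ge0_integral_normal_prob _ t mK); last first.
  by move=> y; apply: integral_ge0 => c _; exact: k0.
pose f (p : R * R) := g p * (normal_pdf m s p.1)%:E.
have mf : measurable_fun setT f.
  by apply: emeasurable_funM => //; exact: measurableT_comp (mpdf m s) _.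
have f0 p : 0 <= f p by rewrite mule_ge0.
transitivity (\int[mu]_c \int[mu]_y f (c, y)).
  apply: eq_integral => c _; rewrite -ge0_integralZr//.
  by apply: measurableT_comp mg _; exact: pair1_measurable.
transitivity (\int[mu]_y \int[mu]_c f (c, y)).
  exact: (@fubini_tonelli _ _ _ _ R mu mu f mf f0).
apply: eq_integral => y _.
have mky : measurable_fun [set: R] (fun c => k (c, y)).
  by apply: measurableT_comp mk _; exact: pair2_measurable.
rewrite -(ge0_integralZr mu measurableT mky (fun _ _ => k0 _) (pdf0 _ _ _)).
apply: eq_integral => c _; rewrite /f /g /k/= -!muleA -!EFinM.
by congr (_ * _%:E); rewrite mulrC (@normal_pdf_bayes m s t)// mulrC.
Qed.

End normal_bayes.

(** * Second moments of normal laws *)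

Section normal_moments.
Context {R : realType}.
Local Notation mu := (@lebesgue_measure R).
Implicit Types (m s t a : R).
Local Open Scope ereal_scope.

Lemma normal_probT m s : normal_prob m s [set: R] = 1.
Proof. exact: (@probability_setT _ _ R (normal_prob m s)). Qed.

Lemma integral_normal_cst m s (r : R) : \int[normal_prob m s]_x r%:E = r%:E.
Proof. by rewrite integral_cst//= normal_probT mule1. Qed.

(** Left as an unevaluated integral: the argument uses only that this number is
    finite and positive. *)
Definition std_normal_var : R := fine (\int[normal_prob 0 1]_x ((x : R) ^+ 2)%:E).

Lemma measurable_sqr_shift (t : R) :
  measurable_fun [set: R] (fun x => ((x + t) ^+ 2)%R%:E).
Proof.
apply/measurable_EFinP; apply: measurable_funX; exact: measurable_funD.
Qed.

(** As x^2 / 4 <= exp (x^2 / 4), the integrand is at most a multiple of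
    exp (- x^2 / 4), an unnormalised normal density of variance 2. *)
Lemma std_normal_var_lty : \int[normal_prob 0 1]_x ((x : R) ^+ 2)%:E < +oo.
Proof.
have msq : measurable_fun [set: R] (fun x : R => (x ^+ 2)%:E).
  by apply/measurable_EFinP; exact: measurable_funX.
rewrite ge0_integral_normal_prob//; last by move=> x; rewrite lee_fin sqr_ge0.
pose q : R := Num.sqrt 2.
have q2 : (q ^+ 2 = 2)%R by rewrite sqr_sqrtr.
have q0 : q != 0%R by rewrite -sqrf_eq0 q2.
(* The factor 4 is that of x^2 <= 4 exp (x^2 / 4); the peaks renormalise. *)
pose K : R := (4 * normal_peak 1 / normal_peak q)%R.
have K0 : (0 <= K)%R by rewrite divr_ge0 ?mulr_ge0 ?normal_peak_ge0.
have mpdf m' s' : measurable_fun [set: R] (fun x => (normal_pdf m' s' x)%:E).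
  by apply/measurable_EFinP; exact: measurable_normal_pdf.
apply: (@le_lt_trans _ _ (\int[mu]_x (K%:E * (normal_pdf 0 q x)%:E))).
  apply: ge0_le_integral => //=.
  - by move=> x _; rewrite mule_ge0// lee_fin ?sqr_ge0 ?normal_pdf_ge0.
  - exact: (emeasurable_funM msq (mpdf 0 1)%R).
  - exact: (emeasurable_funM (measurable_cst _) (mpdf 0 q)%R).
  - move=> x _; rewrite -!EFinM lee_fin !normal_pdfE ?oner_eq0//.
    rewrite /K /normal_fun subr0 expr1n q2.
    have p0 : normal_peak q != 0%R by rewrite gt_eqF ?normal_peak_gt0.
    have -> : (4 * normal_peak 1 / normal_peak q *
      (normal_peak q * expR (- x ^+ 2 / (2 *+ 2))) =
      normal_peak 1 * (4 * expR (- x ^+ 2 / (2 *+ 2))))%R by field.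
    rewrite mulrCA ler_wpM2l ?normal_peak_ge0//.
    have -> : (- x ^+ 2 / (1 *+ 2) =
               - x ^+ 2 / (2 *+ 2) + - (x ^+ 2 / 4))%R by field.
    rewrite expRD expRN mulrCA mulrA ler_pdivrMr ?expR_gt0//.
    have := expR_ge1Dx (x ^+ 2 / 4 : R)%R.
    have := expR_gt0 (- x ^+ 2 / (2 *+ 2) : R)%R.
    by move: (expR _) (expR _) => a b; nra.
rewrite (ge0_integralZl mu measurableT (mpdf 0 q)%R); first last.
- by rewrite lee_fin.
- by move=> x _; rewrite lee_fin normal_pdf_ge0.
by rewrite integral_normal_pdf mule1 ltry.
Qed.

Lemma std_normal_varE :
  \int[normal_prob 0 1]_x ((x : R) ^+ 2)%:E = std_normal_var%:E.
Proof.
rewrite fineK// ge0_fin_numE ?std_normal_var_lty//.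
by apply: integral_ge0 => x _; rewrite lee_fin sqr_ge0.
Qed.

(** Otherwise x^2 would vanish almost surely, that is, the law would be
    concentrated on the null set {0}. *)
Lemma std_normal_var_gt0 : (0 < std_normal_var)%R.
Proof.
rewrite lt_neqAle; apply/andP; split; last first.
  rewrite fine_ge0//; apply: integral_ge0 => x _.
  by rewrite lee_fin sqr_ge0.
apply/eqP => v0.
have msq : measurable_fun [set: R] (fun x : R => (x ^+ 2)%:E).
  by apply/measurable_EFinP; exact: measurable_funX.
have : \int[normal_prob 0 1]_x `|((x : R) ^+ 2)%:E| = 0.
  under eq_integral do rewrite gee0_abs ?lee_fin ?sqr_ge0//.
  by rewrite std_normal_varE -v0.
move=> /(ae_eq_integral_abs (normal_prob 0 1) measurableT msq) [A [mA A0 sub]].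
have AT : A `|` [set (0 : R)%R] = setT.
  apply/seteqP; split => x //= _.
  have [->|x0] := eqVneq x 0%R; [by right | left; apply: sub => /=].
  by move=> /(_ I) []; apply/eqP; rewrite sqrf_eq0.
have P0 : normal_prob 0 1 [set (0 : R)%R] = 0 by rewrite /normal_prob integral_set1.
have : normal_prob 0 1 [set: R] <=
    normal_prob 0 1 A + normal_prob 0 1 [set (0 : R)%R].
  by rewrite -AT; exact: (@measureU2 _ _ R (normal_prob 0 1)).
have -> : normal_prob 0 1 A = 0 by exact: A0.
by rewrite normal_probT P0 adde0 lee_fin ler10.
Qed.

(** The standardisations with slopes s and -s give the same integral; adding them
    cancels the cross term, so the first moment never appears. *)
Lemma normal_second_moment m s t : s != 0%R ->
  \int[normal_prob m s]_x ((x + t) ^+ 2)%R%:E =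
  ((m + t) ^+ 2 + s ^+ 2 * std_normal_var)%R%:E.
Proof.
move=> s0; set b := (m + t)%R.
have sq0 (x : R) : 0 <= (x ^+ 2)%:E by rewrite lee_fin sqr_ge0.
have std a : a != 0%R -> (a ^+ 2 = s ^+ 2)%R ->
    \int[normal_prob m s]_x ((x + t) ^+ 2)%R%:E =
    \int[normal_prob 0 1]_x ((a * x + b) ^+ 2)%R%:E.
  move=> a0 as2.
  rewrite (@normal_prob_sqr R m s a s0 a0 (esym as2)).
  have := @ge0_integral_normal_affine R 0%R 1%R a m _ a0 (oner_neq0 _)
    (measurable_sqr_shift t) (fun=> sq0 _).
  rewrite mulr0 add0r mulr1 => ->; apply: eq_integral => x _.
  by rewrite /b addrA.
set J := \int[normal_prob m s]_x _.
have mI a : measurable_fun [set: R] (fun x => ((a * x + b) ^+ 2)%R%:E).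
  apply/measurable_EFinP; apply: measurable_funX.
  by apply: measurable_funD => //; exact: measurable_funM.
have msq : measurable_fun [set: R] (fun x : R => (x ^+ 2)%:E).
  by apply/measurable_EFinP; exact: measurable_funX.
have JJ : J + J = (2 * (b ^+ 2 + s ^+ 2 * std_normal_var))%R%:E.
  (* The two slopes s and - s have the same square. *)
  rewrite {1}/J (std s)// /J (std (- s)%R) ?oppr_eq0 ?sqrrN//.
  rewrite -ge0_integralD//; [|exact: mI|exact: mI].
  transitivity (\int[normal_prob 0 1]_x
      ((2 * b ^+ 2)%R%:E + (2 * s ^+ 2)%R%:E * ((x : R) ^+ 2)%:E)).
    by apply: eq_integral => x _; rewrite -EFinM -!EFinD; congr EFin; ring.
  have c0 (c : R) : 0 <= (2 * c ^+ 2)%R%:E by rewrite lee_fin mulr_ge0 ?sqr_ge0.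
  rewrite ge0_integralD//=; last 2 first.
  - by move=> x _; rewrite mule_ge0.
  - exact: emeasurable_funM.
  rewrite integral_normal_cst ge0_integralZl//.
  by rewrite std_normal_varE -EFinM -EFinD; congr EFin; ring.
have J0 : 0 <= J by apply: integral_ge0 => x _.
clearbody J; case: J J0 JJ => [r _|//|//] /= [] rr; congr EFin.
by apply: (@mulfI _ 2) => //; rewrite -rr; ring.
Qed.

Lemma normal_second_moment_affine m s a t : s != 0%R ->
  \int[normal_prob m s]_x ((a * x + t) ^+ 2)%R%:E =
  ((a * m + t) ^+ 2 + a ^+ 2 * s ^+ 2 * std_normal_var)%R%:E.
Proof.
move=> s0; have [->|a0] := eqVneq a 0%R.
  under eq_integral do rewrite mul0r.
  by rewrite integral_normal_cst; congr EFin; ring.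
transitivity (\int[normal_prob m s]_x
    ((a ^+ 2)%R%:E * ((x + t / a) ^+ 2)%R%:E)).
  by apply: eq_integral => x _; rewrite -EFinM; congr EFin; field.
rewrite ge0_integralZl//; first last.
- by rewrite lee_fin sqr_ge0.
- by move=> x _; rewrite lee_fin sqr_ge0.
- exact: measurable_sqr_shift.
by rewrite normal_second_moment// -EFinM; congr EFin; field.
Qed.

End normal_moments.

(** * Estimating a normal variable from a noisy observation *)

Section normal_law_integral.
Context {R : realType}.
Context d (Om : measurableType d) (P : probability Om R).
Implicit Types (m s t a v : R).
Local Open Scope ereal_scope.

Definition has_normal_law (X : Om -> R) m v :=
  forall S : set R, measurable S -> P (X @^-1` S) = normal_law m v S.

Lemma ge0_integral_normal_law (X : Om -> R) m v (f : R -> \bar R) :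
  measurable_fun setT X -> (0 < v)%R -> has_normal_law X m v ->
  measurable_fun [set: R] f -> (forall x, 0 <= f x) ->
  \int[P]_om f (X om) = \int[normal_prob m (Num.sqrt v)]_x f x.
Proof.
move=> mX v0 XN mf f0.
have [im imE] := ex_image_measure P
    (mX : measurable_fun _ (X : _ -> measurableTypeR R)).
transitivity (\int[im]_x f x).
  by rewrite imE ge0_integral_pushforward.
apply: eq_measure_integral => A mA _.
by rewrite imE; have := XN A mA; rewrite /normal_law gt_eqF.
Qed.

Lemma integral_sqr_normal_law (X : Om -> R) m v t :
  measurable_fun setT X -> (0 < v)%R -> has_normal_law X m v ->
  \int[P]_om ((X om + t) ^+ 2)%:E = ((m + t) ^+ 2 + v * std_normal_var)%:E.
Proof.
move=> mX v0 XN.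
have f0 (x : R) : 0 <= ((x + t) ^+ 2)%:E by rewrite lee_fin sqr_ge0.
rewrite (ge0_integral_normal_law mX v0 XN (measurable_sqr_shift t) f0).
by rewrite normal_second_moment ?sqr_sqrtr ?ltW// gt_eqF// sqrtr_gt0.
Qed.

(** The joint law of an independent pair is the product of the laws, and Tonelli
    turns the integral against it into an iterated one. *)
Lemma ge0_integral_indep (c z : Om -> R) m v (h : R * R -> \bar R) :
  measurable_fun setT c -> measurable_fun setT z -> (0 < v)%R ->
  has_normal_law c m v -> has_normal_law z 0 1 ->
  (forall S S' : set R, measurable S -> measurable S' ->
    P (c @^-1` S `&` z @^-1` S') = P (c @^-1` S) * P (z @^-1` S')) ->
  measurable_fun setT h -> (forall p, 0 <= h p) ->
  \int[P]_om h (c om, z om) =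
  \int[normal_prob m (Num.sqrt v)]_x \int[normal_prob 0 1]_y h (x, y).
Proof.
move=> mc mz v0 cN zN cz mh h0.
pose cz_ om : measurableTypeR R * measurableTypeR R := (c om, z om).
have mcz : measurable_fun [set: Om] cz_.
  exact: measurable_fun_pair.
have [im imE] := ex_image_measure P mcz.
rewrite -(@fubini_tonelli1 _ _ _ _ R (normal_prob m (Num.sqrt v))
  (normal_prob 0 1) h mh h0).
transitivity (\int[im]_p h p).
  by rewrite imE ge0_integral_pushforward.
apply: eq_measure_integral => A mA _.
apply/esym; apply: product_measure_unique => // S S' mS mS'.
rewrite imE /pushforward (_ : _ @^-1` _ = c @^-1` S `&` z @^-1` S')//.
have := cz S S' mS mS'; rewrite (cN S mS) (zN S' mS') /normal_law gt_eqF// oner_eq0.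
by rewrite sqrtr1.
Qed.

End normal_law_integral.

Section linear_estimation.
Context {R : realType}.
Context d (Om : measurableType d) (P : probability Om R).
Implicit Types (m s t a v : R).
Local Open Scope ereal_scope.

Lemma ge0_integral_observation (c z : Om -> R) m v (u : R)
    (h : R * R -> \bar R) :
  measurable_fun setT c -> measurable_fun setT z -> (0 < v)%R ->
  has_normal_law P c m v -> has_normal_law P z 0 1 ->
  (forall S S' : set R, measurable S -> measurable S' ->
    P (c @^-1` S `&` z @^-1` S') = P (c @^-1` S) * P (z @^-1` S')) ->
  measurable_fun setT h -> (forall p, 0 <= h p) ->
  let s := Num.sqrt v in let t := Num.sqrt (v * u ^+ 2 + 1) in
  \int[P]_om h (c om, u * c om + z om)%R =
  \int[normal_prob (u * m) t]_y
     \int[normal_prob (posterior_mean m s u y) (s / t)]_x h (x, y).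
Proof.
move=> mc mz v0 cN zN cz mh h0 s t.
have s0 : s != 0%R by rewrite gt_eqF// sqrtr_gt0.
have w0 : (0 < v * u ^+ 2 + 1)%R by rewrite ltr_wpDl// mulr_ge0 ?sqr_ge0 ?ltW.
have t0 : t != 0%R by rewrite gt_eqF// sqrtr_gt0.
pose h' (p : R * R) := h (p.1, u * p.1 + p.2)%R.
have mh' : measurable_fun setT h'.
  apply: measurableT_comp mh _; apply: measurable_fun_pair => //.
  by apply: measurable_funD => //; exact: measurable_funM.
have -> : \int[P]_om h (c om, u * c om + z om)%R =
          \int[P]_om h' (c om, z om) by [].
rewrite (ge0_integral_indep mc mz v0 cN zN cz mh' (fun=> h0 _)).
apply: normal_bayes => //.
by rewrite /s /t !sqr_sqrtr// ltW.
Qed.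

(** The minimum of E[(c + a)^2 + a^2] over actions a that depend on u c + z only,
    where c ~ N(m, v) and z ~ N(0, 1): conditionally on the observation the best
    a is minus half the posterior mean, which leaves the posterior variance plus
    half the square of the posterior mean. *)
Definition min_correction_cost m v (u : R) : R :=
  (std_normal_var * v / (v * u ^+ 2 + 1) + m ^+ 2 + v * std_normal_var) / 2.

Variables (c z : Om -> R) (m v u : R).
Hypotheses (mc : measurable_fun setT c) (mz : measurable_fun setT z).
Hypotheses (v0 : (0 < v)%R) (cN : has_normal_law P c m v)
  (zN : has_normal_law P z 0 1).
Hypothesis cz : forall S S' : set R, measurable S -> measurable S' ->
  P (c @^-1` S `&` z @^-1` S') = P (c @^-1` S) * P (z @^-1` S').

Let s := Num.sqrt v.
Let t := Num.sqrt (v * u ^+ 2 + 1).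
Let w0 : (0 < v * u ^+ 2 + 1)%R.
Proof. by rewrite ltr_wpDl// mulr_ge0 ?sqr_ge0 ?ltW. Qed.
Let s0 : s != 0%R. Proof. by rewrite gt_eqF// sqrtr_gt0. Qed.
Let t0 : t != 0%R. Proof. by rewrite gt_eqF// sqrtr_gt0. Qed.
Let st0 : (s / t)%R != 0%R. Proof. by rewrite mulf_neq0// invr_eq0. Qed.
Let st2 : ((s / t) ^+ 2 = v / (v * u ^+ 2 + 1))%R.
Proof. by rewrite expr_div_n !sqr_sqrtr ?ltW. Qed.

Let correction (f : R -> R) (p : R * R) :=
  ((p.1 + f p.2) ^+ 2 + f p.2 ^+ 2)%:E.

Let measurable_correction f : measurable_fun setT f ->
  measurable_fun setT (correction f).
Proof.
move=> mf; apply/measurable_EFinP.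
have mf2 : measurable_fun [set: R * R] (fun p : R * R => f p.2).
  exact: measurableT_comp mf _.
apply: measurable_funD; apply: measurable_funX => //.
exact: measurable_funD.
Qed.

Let correction_ge0 f p : 0 <= correction f p.
Proof. by rewrite lee_fin addr_ge0 ?sqr_ge0. Qed.

(** Conditionally on y the action is a constant, so the inner integral is a second
    moment of the posterior law. *)
Let integral_correction f : measurable_fun setT f ->
  \int[P]_om ((c om + f (u * c om + z om)) ^+ 2
              + f (u * c om + z om) ^+ 2)%:E =
  \int[normal_prob (u * m) t]_y
    (((posterior_mean m s u y) + f y) ^+ 2 + f y ^+ 2 +
      std_normal_var * v / (v * u ^+ 2 + 1))%:E.
Proof.
move=> mf.
have := ge0_integral_observation u mc mz v0 cN zN cz (measurable_correction mf)
  (correction_ge0 f).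
rewrite /= -/s -/t => ->; apply: eq_integral => y _; rewrite /correction/=.
under eq_integral do rewrite EFinD.
rewrite ge0_integralD//; first last.
- by move=> x _; rewrite lee_fin sqr_ge0.
- exact: measurable_sqr_shift.
- by move=> x _; rewrite lee_fin sqr_ge0.
rewrite normal_second_moment// integral_normal_cst -EFinD st2; congr EFin.
by ring.
Qed.

Let integral_min_correction :
  \int[normal_prob (u * m) t]_y
    ((posterior_mean m s u y ^+ 2 / 2)%R +
     std_normal_var * v / (v * u ^+ 2 + 1))%:E = (min_correction_cost m v u)%:E.
Proof.
under eq_integral do rewrite EFinD.
have mp : measurable_fun [set: R] (fun y => (posterior_mean m s u y ^+ 2 / 2)%:E).
  apply/measurable_EFinP; apply: measurable_funM => //; apply: measurable_funX.
  exact: measurable_posterior_mean.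
rewrite ge0_integralD//; first last.
- by move=> x _; rewrite lee_fin ltW// divr_gt0// mulr_gt0// std_normal_var_gt0.
- by move=> x _; rewrite lee_fin divr_ge0// sqr_ge0.
rewrite integral_normal_cst.
pose K : R := (s ^+ 2 * u / (s ^+ 2 * u ^+ 2 + 1))%R.
have -> : \int[normal_prob (u * m) t]_y (posterior_mean m s u y ^+ 2 / 2)%:E =
    (2^-1)%:E * \int[normal_prob (u * m) t]_y ((K * y + (m - K * (u * m))) ^+ 2)%:E.
  rewrite -ge0_integralZl//; first last.
  - by move=> y _; rewrite lee_fin sqr_ge0.
  - apply/measurable_EFinP; apply: measurable_funX.
    by apply: measurable_funD => //; exact: measurable_funM.
  apply: eq_integral => y _; rewrite -EFinM mulrC; congr (_ * _ ^+ 2)%:E.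
  by rewrite /posterior_mean -/K; ring.
rewrite normal_second_moment_affine// -EFinM -EFinD; congr EFin.
rewrite /K /t !sqr_sqrtr ?ltW// /min_correction_cost.
by field; rewrite gt_eqF.
Qed.

(** Pointwise in y, (m + a)^2 + a^2 exceeds m^2 / 2 by 2 (a + m / 2)^2, with m the
    posterior mean. *)
Lemma min_correction_cost_le (f : R -> R) : measurable_fun setT f ->
  (min_correction_cost m v u)%:E <=
  \int[P]_om ((c om + f (u * c om + z om)) ^+ 2
              + f (u * c om + z om) ^+ 2)%:E.
Proof.
move=> mf; rewrite integral_correction// -integral_min_correction.
have K0 : (0 <= std_normal_var * v / (v * u ^+ 2 + 1))%R.
  by rewrite ltW// divr_gt0// mulr_gt0// std_normal_var_gt0.
have mp := measurable_posterior_mean m s u.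
apply: ge0_le_integral => //.
- by move=> y _; rewrite lee_fin addr_ge0// divr_ge0// sqr_ge0.
- apply/measurable_EFinP; apply: measurable_funD => //.
  by apply: measurable_funM => //; exact: measurable_funX.
- apply/measurable_EFinP; apply: measurable_funD => //.
  by apply: measurable_funD; apply: measurable_funX => //; exact: measurable_funD.
- move=> y _; rewrite lee_fin lerD2r.
  move: (posterior_mean _ _ _ _) (f y) => a b; rewrite -subr_ge0.
  have -> : ((a + b) ^+ 2 + b ^+ 2 - a ^+ 2 / 2 = 2 * (b + a / 2) ^+ 2)%R by field.
  by rewrite mulr_ge0 ?sqr_ge0.
Qed.

Lemma min_correction_cost_eq :
  let f y := (- posterior_mean m s u y / 2)%R in
  \int[P]_om ((c om + f (u * c om + z om)) ^+ 2
              + f (u * c om + z om) ^+ 2)%:E = (min_correction_cost m v u)%:E.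
Proof.
move=> f; rewrite integral_correction; last first.
  apply: measurable_funM => //; apply: measurable_funN.
  exact: measurable_posterior_mean.
rewrite -integral_min_correction; apply: eq_integral => y _; congr EFin.
by rewrite /f; field; rewrite gt_eqF.
Qed.

End linear_estimation.

(** * Sums of independent normal variables *)

Section gaussian_product.
Context {R : realType}.
Implicit Types (m s t a v : R).
Local Open Scope ereal_scope.

Lemma normal_law_sqr m s : s != 0%R -> normal_law m (s ^+ 2) = normal_prob m s.
Proof.
move=> s0; apply/funext => A; rewrite /normal_law sqrf_eq0 (negbTE s0).
rewrite sqrtr_sqr (@normal_prob_sqr R m `|s| s) ?normr_eq0//.
by rewrite real_normK// num_real.
Qed.

Lemma normal_law_gt0 m v : (0 < v)%R -> normal_law m v = normal_prob m (Num.sqrt v).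
Proof.
by move=> v0; apply/funext => A; rewrite /normal_law gt_eqF.
Qed.

(** [normal_law] covers the slope a = 0, where the image is a point mass. *)
Lemma normal_prob_affine_law m s a t (S : set R) : s != 0%R -> measurable S ->
  normal_prob m s [set x | S (a * x + t)%R] =
  normal_law (a * m + t) (a ^+ 2 * s ^+ 2) S.
Proof.
move=> s0 mS; have [->|a0] := eqVneq a 0%R; last first.
  have -> : (a ^+ 2 * s ^+ 2 = (a * s) ^+ 2)%R by rewrite exprMn.
  rewrite (@normal_law_sqr _ (a * s)%R (mulf_neq0 a0 s0)).
  exact/esym/(@normal_prob_affine R m s a t S a0 s0 mS).
rewrite expr0n/= !mul0r add0r /normal_law eqxx diracE.
have [tS|tS] := boolP (t \in S).
  rewrite (_ : [set x | _] = setT) ?normal_probT//.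
  by apply/seteqP; split => x //= _; rewrite mul0r add0r; exact: set_mem.
rewrite (_ : [set x | _] = set0) ?measure0//.
apply/seteqP; split => x //=; rewrite mul0r add0r => St.
by move: tS; rewrite mem_set.
Qed.

Section step.
Context d (Om : measurableType d) (P : probability Om R).

(** The law of X + a Z for Z standard normal and independent of X.  If a is not
    zero, X + a Z = a (X / a + Z) and the evidence in [normal_bayes] is the law of
    X / a + Z; if v = 0 or a = 0, one of the two summands is a point mass. *)
Lemma normal_law_add (X : Om -> R) m v a :
  measurable_fun setT X -> (0 <= v)%R -> has_normal_law P X m v ->
  has_normal_law (P \x normal_prob 0 1)
    (fun p : Om * measurableTypeR R => X p.1 + a * p.2)%R m (v + a ^+ 2).
Proof.
move=> mX v0 XN S mS.
have mphi : measurable_fun [set: Om * measurableTypeR R]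
    (fun p : Om * measurableTypeR R => X p.1 + a * p.2)%R.
  apply: measurable_funD; first exact: measurableT_comp mX _.
  by apply: measurable_funM => //.
pose psi (x : R) := normal_law x (a ^+ 2) S.
have psiE x : psi x = normal_prob 0 1 [set y : R | S (a * y + x)%R].
  rewrite (@normal_prob_affine_law 0 1 a x S (oner_neq0 _) mS)%R.
  by rewrite mulr0 add0r expr1n mulr1.
transitivity (\int[P]_om psi (X om)).
  rewrite /= /product_measure1; apply: eq_integral => om _ /=.
  rewrite psiE; congr (normal_prob 0 1 _).
  apply/seteqP; split => y; rewrite /xsection/= inE/=.
    by rewrite addrC.
  by rewrite addrC.
have mE : measurable [set p : R * R | S (a * p.2 + p.1)%R].
  have : measurable_fun [set: R * R] (fun p : R * R => (a * p.2 + p.1)%R).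
    by apply: measurable_funD => //; exact: measurable_funM.
  by move=> /(_ measurableT _ mS); rewrite setTI.
have mpsi : measurable_fun [set: R] psi.
  have := @measurable_fun_xsection _ _ _ _ R (normal_prob 0 1) _ mE.
  apply: eq_measurable_fun => x _; rewrite psiE /=; congr (normal_prob 0 1 _).
  by apply/seteqP; split => y; rewrite /xsection/= inE.
have psi0 x : 0 <= psi x by rewrite psiE.
have [v00|v1] := eqVneq v 0%R.
  have [im imE] := ex_image_measure P
    (mX : measurable_fun _ (X : _ -> measurableTypeR R)).
  transitivity (\int[im]_x psi x); first by rewrite imE ge0_integral_pushforward.
  transitivity (\int[\d_(m : measurableTypeR R)]_x psi x).
    apply: eq_measure_integral => A mA _.
    by rewrite imE; have := XN A mA; rewrite /normal_law v00 eqxx.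
  by rewrite integral_dirac// diracT mul1e v00 add0r.
have vgt0 : (0 < v)%R by rewrite lt_neqAle eq_sym v1.
have sv0 : Num.sqrt v != 0%R by rewrite gt_eqF// sqrtr_gt0.
rewrite (ge0_integral_normal_law mX vgt0 XN mpsi psi0).
have [a0|a0] := eqVneq a 0%R.
  rewrite a0 expr0n addr0 normal_law_gt0//.
  transitivity (\int[normal_prob m (Num.sqrt v)]_x (\1_S x)%:E).
    by apply: eq_integral => x _; rewrite /psi a0 expr0n /normal_law eqxx.
  by rewrite integral_indic// setIT.
pose t := Num.sqrt (v * a^-1 ^+ 2 + 1).
have t2 : (t ^+ 2 = v * a^-1 ^+ 2 + 1)%R.
  by rewrite sqr_sqrtr// addr_ge0// mulr_ge0// sqr_ge0.
have t0 : t != 0%R.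
  by rewrite -sqrf_eq0 t2 gt_eqF// ltr_wpDl// mulr_ge0// sqr_ge0.
have mSa : measurable [set y : R | S (a * y + 0)%R].
  have : measurable_fun [set: R] (fun y : R => (a * y + 0)%R).
    by apply: measurable_funD => //; exact: measurable_funM.
  by move=> /(_ measurableT _ mS); rewrite setTI.
pose h (p : R * R) : \bar R := (\1_[set y : R | S (a * y + 0)%R] p.2)%:E.
have mh : measurable_fun setT h.
  apply/measurable_EFinP; apply: measurableT_comp => //.
have h0 p : 0 <= h p by rewrite lee_fin.
transitivity (\int[normal_prob m (Num.sqrt v)]_c
    \int[normal_prob 0 1]_z h (c, (a^-1 * c + z)%R)).
  apply: eq_integral => c _; rewrite psiE.
  transitivity (\int[normal_prob 0 1]_z (\1_[set y : R | S (a * y + c)%R] z)%:E).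
    rewrite integral_indic// ?setIT//.
    have : measurable_fun [set: R] (fun y : R => (a * y + c)%R).
      by apply: measurable_funD => //; exact: measurable_funM.
    by move=> /(_ measurableT _ mS); rewrite setTI.
  apply: eq_integral => z _; rewrite /h/= !indicE; congr ((_ : bool)%:R%:E).
  apply/idP/idP; rewrite !inE/= => H; move: H; congr S.
    by field.
  by field.
rewrite (@normal_bayes R m (Num.sqrt v) t a^-1 h sv0 t0 _ mh h0); last first.
  by rewrite t2 sqr_sqrtr.
transitivity (\int[normal_prob (a^-1 * m) t]_y
    (\1_[set y : R | S (a * y + 0)%R] y)%:E).
  by apply: eq_integral => y _; rewrite /h/= integral_normal_cst.
transitivity (normal_prob (a^-1 * m) t [set y : R | S (a * y + 0)%R]).
  by rewrite integral_indic// setIT.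
rewrite (@normal_prob_affine_law (a^-1 * m) t a 0 S t0 mS)%R t2.
by congr (normal_law _ _ S); field.
Qed.

End step.

End gaussian_product.

(** * A probability space carrying the noises *)

Section measurable_matrix_fun.
Context {R : realType} {m n : nat}.
Context d (T : measurableType d).

Lemma measurable_mx (f : T -> 'M[R]_(m, n)) :
  (forall i j, measurable_fun setT (fun x => f x i j)) -> measurable_fun setT f.
Proof.
move=> mf; apply: (measurability (@entry_cylinders R m n)) => //.
move=> _ [_ [i [j [S [mS ->]]]] <-].
exact: mf.
Qed.

Lemma measurable_entry (f : T -> 'M[R]_(m, n)) i j :
  measurable_fun setT f -> measurable_fun setT (fun x => f x i j).
Proof.
move=> mf.
have me : measurable_fun setT (fun M : 'M[R]_(m, n) => M i j).
  by move=> _ S mS; rewrite setTI; apply: sub_sigma_algebra; exists i, j, S.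
exact: measurableT_comp me mf.
Qed.

End measurable_matrix_fun.

Lemma ex_RV (R : realType) d d' (Om : measurableType d) (T : measurableType d')
    (P : probability Om R) (X : Om -> T) :
  measurable_fun setT X -> exists X' : {RV P >-> T}, X' = X :> (_ -> _).
Proof.
move=> mX.
pose mX_mixin := isMeasurableFun.Build _ _ _ _ _ mX.
pose X' : {mfun _ >-> _} := HB.pack X mX_mixin.
by exists X'.
Qed.

Section existence.
Context {R : realType}.
Local Open Scope ereal_scope.

(** Each further variable is a new factor of a product space.  The law of every
    linear combination is carried through the induction, since this is the form in
    which Gaussian vectors are defined. *)
Lemma ex_gaussian_family n : exists (d : measure_display)
    (Om : measurableType d) (P : probability Om R) (g : nat -> Om -> R),
  (forall i, measurable_fun setT (g i)) /\
  forall (a : 'I_n -> R) (mu : R),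
    has_normal_law P (fun om => mu + \sum_(i < n) a i * g i om)%R mu
      (\sum_(i < n) a i ^+ 2)%R.
Proof.
elim: n => [|n [d [Om [P [g [mg gN]]]]]].
  exists _, (measurableTypeR R), (normal_prob 0 1), (fun _ _ => 0%R).
  split=> [//|a mu S mS].
  rewrite /normal_law !big_ord0 eqxx addr0 diracE.
  rewrite (preimage_cst (aT := measurableTypeR R)).
  by case: ifP => _; [exact: normal_probT | exact: measure0].
exists _, (Om * measurableTypeR R)%type, (P \x normal_prob 0 1)%E.
exists (fun i p => if i == n then p.2 else g i p.1); split.
  move=> i; case: eqP => _; first exact: measurable_snd.
  by apply: measurableT_comp (mg i) _.
move=> a mu S mS; rewrite [in RHS]big_ord_recr/=.
pose a' i := a (widen_ord (leqnSn n) i).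
have mX : measurable_fun setT (fun om => mu + \sum_(i < n) a' i * g i om)%R.
  apply: measurable_funD => //; apply: measurable_sum => i.
  by apply: measurable_funM.
have v0 : (0 <= \sum_(i < n) a' i ^+ 2)%R.
  by apply: sumr_ge0 => i _; rewrite sqr_ge0.
rewrite -(normal_law_add (a ord_max) mX v0 (gN a' mu) mS).
congr ((P \x normal_prob 0 1) _); apply/funext => p /=.
rewrite big_ord_recr/= eqxx addrA; congr (S (_ + _ + _)%R).
by apply: eq_bigr => i _; rewrite ltn_eqF.
Qed.

(** Enlarges a given space by independent standard normal variables, keeping the
    old events with their probabilities.  Stating independence against all events
    of the old space covers the initial state, whose events are not rectangles. *)
Lemma ex_independent_normals d (Om : measurableType d) (P : probability Om R) q :
  exists (d' : measure_display) (Om' : measurableType d')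
    (P' : probability Om' R) (pr : Om' -> Om) (Z : nat -> Om' -> R),
  [/\ measurable_fun setT pr, (forall i, measurable_fun setT (Z i)) &
    forall (E : set Om) (G : nat -> set R), measurable E ->
      (forall i, measurable (G i)) ->
      P' (pr @^-1` E `&` \bigcap_(i in [set i | (i < q)%N]) (Z i @^-1` G i)) =
      P E * \prod_(0 <= i < q) normal_prob 0 1 (G i)].
Proof.
elim: q => [|q [d' [Om' [P' [pr [Z [mpr mZ PZ]]]]]]].
  exists _, Om, P, id, (fun _ _ => 0%R); split => // E G mE mG.
  rewrite big_geq// mule1 (_ : [set i | _] = set0) ?bigcap_set0 ?setIT//.
  by apply/seteqP; split => x.
exists _, (Om' * measurableTypeR R)%type, (P' \x normal_prob 0 1)%E.
exists (fun p => pr p.1), (fun i p => if i == q then p.2 else Z i p.1); split.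
- exact: measurableT_comp mpr _.
- move=> i; case: eqP => _; first exact: measurable_snd.
  by apply: measurableT_comp (mZ i) _.
- move=> E G mE mG; rewrite big_nat_recr//= muleA -PZ//.
  pose A := pr @^-1` E `&` \bigcap_(i in [set i | (i < q)%N]) (Z i @^-1` G i).
  have mA : measurable A.
    apply: measurableI; first by have := mpr measurableT E mE; rewrite setTI.
    apply: bigcap_measurableType => i _.
    by have := mZ i measurableT (G i) (mG i); rewrite setTI.
  transitivity ((P' \x normal_prob 0 1)
      (A `*` (G q : set (measurableTypeR R)))); last first.
    exact: (@product_measure1E _ _ _ _ R P' (normal_prob 0 1) _ _ mA (mG q)).
  congr ((P' \x normal_prob 0 1) _); apply/seteqP; split => -[x y]/=.
    move=> [Ex H]; split; last by have := H q (ltnSn _); rewrite /= eqxx.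
    split => // i /= iq; have := H i (ltnW iq).
    by rewrite /= ltn_eqF.
  move=> [[Ex H] Gy]; split => // i /=; have [->//|iq] := eqVneq i q.
  by rewrite ltnS leq_eqVlt (negbTE iq)/=; exact: H.
Qed.

End existence.

Section noise_existence.
Context {R : realType}.
Local Open Scope ereal_scope.

(** Optimality over all noise models is vacuous where there is none; this provides
    one for the identity prior covariance. *)
Lemma ex_noise_model n p (D : plant R n p 1) (T k : nat) (xhat : 'cV[R]_n) :
  covw D = 0%R -> covz D = 1%:M%R -> (k <= T)%N ->
  exists (d : measure_display) (Om : measurableType d) (P : probability Om R),
    inhabited (noise_model D T k xhat 1%:M%R P).
Proof.
move=> Dw Dz kT.
have [d0 [Om0 [P0 [g [mg gN]]]]] := @ex_gaussian_family R n.
have [d [Om [P [pr [Z [mpr mZ PZ]]]]]] := ex_independent_normals P0 T.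
exists d, Om, P.
have Ppr E : measurable E -> P (pr @^-1` E) = P0 E.
  move=> mE; have := PZ E (fun=> setT) mE (fun=> measurableT).
  rewrite (_ : \bigcap_(i in _) _ = setT) ?setIT; last first.
    by apply/seteqP; split.
  by move=> ->; rewrite big1 ?mule1// => i _; exact: normal_probT.
have PZt t S : (t < T)%N -> measurable S -> P (Z t @^-1` S) = normal_prob 0 1 S.
  move=> tT mS; pose G i : set R := if i == t then S else setT.
  have mG i : measurable (G i) by rewrite /G; case: eqP.
  have := PZ setT G measurableT mG.
  rewrite preimage_setT setTI probability_setT mul1e.
  rewrite (_ : \bigcap_(i in _) _ = Z t @^-1` S); last first.
    apply/seteqP; split => om /=; first by move=> /(_ t tT)/=; rewrite /G eqxx.
    by move=> St i _ /=; rewrite /G; case: eqP => [->|].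
  move=> ->; rewrite big_mkord (bigD1 (Ordinal tT))//= big1 ?mule1 /G ?eqxx//.
  move=> i; rewrite -val_eqE/= => /negbTE ->; exact: normal_probT.
have mX : measurable_fun setT (fun om => \col_(i < n) (xhat i 0 + g i (pr om)))%R.
  apply: measurable_mx => i j.
  rewrite (_ : (fun _ => _) = fun om => (xhat i 0 + g i (pr om))%R); last first.
    by apply/funext => om; rewrite mxE.
  by apply: measurable_funD => //; exact: measurableT_comp (mg i) mpr.
have [X XE] := ex_RV P mX.
have [W WE] := ex_RV P (measurable_cst (0 : 'cV[R]_n)%R).
have mz t : measurable_fun setT (fun om => const_mx (Z t om) : 'cV[R]_1).
  apply: measurable_mx => i j.
  by rewrite (_ : (fun _ => _) = Z t)//; apply/funext => om; rewrite mxE.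
have [z zE] := choice (fun t => ex_RV P (mz t)).
have XG : is_gaussian X xhat 1%:M%R.
  move=> a S mS.
  have aX om : ((a^T *m X om) 0 0 = (a^T *m xhat) 0 0
      + \sum_(i < n) a i 0 * g i (pr om))%R.
    rewrite XE !mxE -big_split/=; apply: eq_bigr => i _.
    by rewrite !mxE mulrDr.
  have qa : (qform 1%:M a = \sum_(i < n) a i 0 ^+ 2)%R.
    rewrite /qform mulmx1 mxE; apply: eq_bigr => i _.
    by rewrite mxE expr2.
  have := gN (fun i => a i 0%R) ((a^T *m xhat) 0 0)%R S mS.
  rewrite qa => <-; rewrite -Ppr.
    by congr (P _); apply/funext => om /=; rewrite aX.
  have mf : measurable_fun setT (fun om => (a^T *m xhat) 0 0
      + \sum_(i < n) a i 0 * g i om)%R.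
    apply: measurable_funD => //; apply: measurable_sum => i.
    by apply: measurable_funM.
  by have := mf measurableT S mS; rewrite setTI.
have WG t : (k <= t < T)%N -> is_gaussian W 0%R (covw D).
  move=> _ a S mS; rewrite Dw /qform !mulmx0 mul0mx !mxE /normal_law eqxx.
  rewrite (_ : [set om | _] = cst 0%R @^-1` S); last first.
    by apply/funext => om /=; rewrite WE mulmx0 mxE.
  rewrite preimage_cst diracE.
  by case: ifP => _; [exact: probability_setT | exact: measure0].
have ZG t : (k <= t < T)%N -> is_gaussian (z t) 0%R (covz D).
  move=> /andP[_ tT] a S mS; rewrite Dz.
  have := @normal_prob_affine_law R 0%R 1%R (a 0 0)%R 0%R S (oner_neq0 _) mS.
  rewrite /qform mulmx1 mulmx0 !mxE big_ord1 mxE mulr0 addr0 expr1n mulr1.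
  rewrite expr2 => <-; rewrite -(PZt t)//.
    congr (P _); apply/funext => om /=.
    by rewrite zE mxE big_ord1 !mxE addr0.
  have mf : measurable_fun [set: R] (fun x : R => a 0%R 0%R * x + 0)%R.
    by apply: measurable_funD => //; apply: measurable_funM.
  by have := mf measurableT S mS; rewrite setTI.
constructor.
apply: (@NoiseModel _ _ _ _ D T k xhat 1%:M%R d Om P X (fun=> W) z XG WG ZG).
move=> E F G mE mF mG.
(* The process noise is constantly 0, so an event about it is sure or impossible;
   it is absorbed into the event about the measurement noise. *)
pose GZ t : set R := if `[< F t 0%R >]
  then [set x : R | G t (const_mx x : 'cV[R]_1)] else set0.
have mGZ t : measurable (GZ t).
  rewrite /GZ; case: asboolP => // _.
  have mc : measurable_fun [set: R] (fun x : R => const_mx x : 'cV[R]_1).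
    apply: measurable_mx => i j.
    by rewrite (_ : (fun _ => _) = id)//; apply/funext => x; rewrite mxE.
  by have := mc measurableT _ (mG t); rewrite setTI.
have WZ t : W @^-1` F t `&` z t @^-1` G t = Z t @^-1` GZ t.
  apply/seteqP; split => om /=; rewrite WE zE /GZ.
    by move=> [F0 Gz]; case: asboolP.
  by case: asboolP.
have PWZ t : (k <= t < T)%N ->
    P (W @^-1` F t) * P (z t @^-1` G t) = normal_prob 0 1 (GZ t).
  move=> /andP[_ tT]; rewrite -(PZt t)// -WZ WE preimage_cst.
  case: ifP => _; first by rewrite setTI probability_setT mul1e.
  by rewrite set0I measure0 mul0e.
pose E0 := (fun om0 => (\col_(i < n) (xhat i 0 + g i om0))%R) @^-1` E.
have mE0 : measurable E0.
  have mX0 : measurable_fun setT (fun om => \col_(i < n) (xhat i 0 + g i om))%R.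
    apply: measurable_mx => i j.
    rewrite (_ : (fun _ => _) = fun om => (xhat i 0 + g i om)%R); last first.
      by apply/funext => om; rewrite mxE.
    exact: measurable_funD.
  by have := mX0 measurableT _ mE; rewrite setTI.
have XE0 : X @^-1` E = pr @^-1` E0 by rewrite XE.
(* The variables before time k exist but are left unconstrained. *)
pose G' t : set R := if (k <= t)%N then GZ t else setT.
have mG' t : measurable (G' t) by rewrite /G'; case: ifP.
rewrite XE0 (Ppr _ mE0).
transitivity (P (pr @^-1` E0 `&`
    \bigcap_(i in [set i | (i < T)%N]) (Z i @^-1` G' i))).
  congr (P (_ `&` _)); apply/seteqP; split => om /= H t /=.
    move=> tT; rewrite /G'; case: ifP => // kt.
    rewrite -[GZ t _]/((Z t @^-1` GZ t) om) -WZ.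
    by apply: H; rewrite /= kt.
  move=> /andP[kt tT]; have := H t tT; rewrite /G' kt.
  by rewrite -WZ.
rewrite (PZ E0 G' mE0 mG'); congr (_ * _).
rewrite (big_cat_nat (leq0n k) kT)/= big_nat_cond big1 ?mul1e.
  rewrite big_nat_cond [RHS]big_nat_cond; apply: eq_bigr => t /andP[ktT _].
  by rewrite (PWZ _ ktT) /G'; case/andP: ktT => ->.
move=> t /andP[/andP[_ tk] _]; rewrite /G' leqNgt tk; exact: normal_probT.
Qed.

End noise_existence.

(** * Measurability of the closed loop *)

Section measurable_matrix_ops.
Context {R : realType} {d} {T : measurableType d}.

Lemma measurable_mulmx m n p (f : T -> 'M[R]_(m, n)) (g : T -> 'M[R]_(n, p)) :
  measurable_fun setT f -> measurable_fun setT g ->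
  measurable_fun setT (fun x => f x *m g x).
Proof.
move=> mf mg; apply: measurable_mx => i j.
rewrite (_ : (fun _ => _) = fun x => \sum_k f x i k * g x k j); last first.
  by apply/funext => x; rewrite mxE.
by apply: measurable_sum => k; apply: measurable_funM; exact: measurable_entry.
Qed.

Lemma measurable_addmx m n (f g : T -> 'M[R]_(m, n)) :
  measurable_fun setT f -> measurable_fun setT g ->
  measurable_fun setT (fun x => f x + g x).
Proof.
move=> mf mg; apply: measurable_mx => i j.
rewrite (_ : (fun _ => _) = fun x => f x i j + g x i j); last first.
  by apply/funext => x; rewrite mxE.
by apply: measurable_funD; exact: measurable_entry.
Qed.

Lemma measurable_qform n (M : 'M[R]_n) (f : T -> 'cV[R]_n) :
  measurable_fun setT f -> measurable_fun setT (fun x => qform M (f x)).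
Proof.
move=> mf; apply: (measurable_entry (f := fun x => (f x)^T *m M *m f x)).
apply: measurable_mulmx => //; apply: measurable_mulmx => //.
apply: measurable_mx => i j.
rewrite (_ : (fun _ => _) = fun x => f x j i); first exact: measurable_entry.
by apply/funext => x; rewrite mxE.
Qed.

End measurable_matrix_ops.

Section measurable_closed_loop.
Context {R : realType} {n p m : nat} {D : plant R n p m}.
Context {T k : nat} {xhat : 'cV[R]_n} {Sigma : 'M[R]_n}.
Context {d : measure_display} {Om : measurableType d} {P : probability Om R}.
Variables (N : noise_model D T k xhat Sigma P).
Variable pi : policy (R := R) (p := p) (m := m).
Hypothesis pi_adm : admissible pi.

(** The history grows by one entry per step, so its measurability is checked entry
    by entry: the last one is new, the others come from the previous history. *)
Lemma measurable_trajectory j :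
  measurable_fun setT (fun om => trajectory N pi om j).
Proof.
elim: j => [|j IH].
  by apply: measurable_fun_pair => //; exact: measurable_funP.
have mx : measurable_fun setT (fun om => (trajectory N pi om j).1).
  exact: measurableT_comp measurable_fst IH.
have mh : measurable_fun setT (fun om => (trajectory N pi om j).2).
  exact: measurableT_comp measurable_snd IH.
have mu : measurable_fun setT (fun om => pi (trajectory N pi om j).2).
  exact: measurableT_comp (@pi_adm j) mh.
have mC : measurable_fun setT
    (fun om => obs_matrix D (pi (trajectory N pi om j).2)).
  rewrite /obs_matrix; apply: measurable_addmx => //.
  apply: measurable_mx => i l.
  rewrite (_ : (fun _ => _) = fun om =>
    \sum_(q < p) pi (trajectory N pi om j).2 q 0 * obsC D q i l); last first.
    by apply/funext => om; rewrite summxE; apply: eq_bigr => q _; rewrite mxE.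
  apply: measurable_sum => q; apply: measurable_funM => //.
  exact: measurable_entry mu.
have my : measurable_fun setT (fun om => obs_matrix D (pi (trajectory N pi om j).2)
    *m (trajectory N pi om j).1 + znoise N (k + j) om).
  by apply: measurable_addmx; [exact: measurable_mulmx|exact: measurable_funP].
rewrite (_ : (fun _ => _) = fun om =>
  (dynA D *m (trajectory N pi om j).1 + dynB D *m pi (trajectory N pi om j).2
     + wnoise N (k + j) om,
   [tuple of rcons (trajectory N pi om j).2 (pi (trajectory N pi om j).2,
     obs_matrix D (pi (trajectory N pi om j).2) *m (trajectory N pi om j).1
     + znoise N (k + j) om)])); last first.
  by apply/funext => om /=; case: (trajectory N pi om j).
apply: measurable_fun_pair.
  apply: measurable_addmx; last exact: measurable_funP.
  by apply: measurable_addmx; exact: measurable_mulmx.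
apply/measurable_fun_tnthP => i.
have [ij|ij] := ltnP i j.
  rewrite (_ : _ \o _ = fun om => tnth (trajectory N pi om j).2 (Ordinal ij)).
    by move/measurable_fun_tnthP : mh => /(_ (Ordinal ij)).
  apply/funext => om /=.
  rewrite !(tnth_nth (0, 0))/= nth_rcons size_tuple ij.
  by [].
have -> : i = ord_max.
  by apply/val_inj/eqP => /=; rewrite eqn_leq ij -ltnS ltn_ord.
rewrite (_ : _ \o _ = fun om => (pi (trajectory N pi om j).2,
     obs_matrix D (pi (trajectory N pi om j).2) *m (trajectory N pi om j).1
     + znoise N (k + j) om)); first exact: measurable_fun_pair.
by apply/funext => om /=; rewrite (tnth_nth (0, 0))/= nth_rcons size_tuple ltnn eqxx.
Qed.

Lemma measurable_state j : measurable_fun setT (fun om => state N pi om j).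
Proof.
have mt := @measurable_trajectory j.
exact: measurableT_comp measurable_fst mt.
Qed.

Lemma measurable_input j : measurable_fun setT (fun om => input N pi om j).
Proof.
have mt := @measurable_trajectory j.
have mh : measurable_fun setT (fun om => (trajectory N pi om j).2).
  exact: measurableT_comp measurable_snd mt.
exact: measurableT_comp (@pi_adm j) mh.
Qed.

Lemma stateS om j : state N pi om j.+1 = dynA D *m state N pi om j
  + dynB D *m input N pi om j + wnoise N (k + j) om.
Proof. by rewrite /state /input/=; case: (trajectory N pi om j). Qed.

Lemma input1 om : input N pi om 1 = @pi 1%N [tuple (first_action pi,
   obs_matrix D (first_action pi) *m init N om + znoise N k om)].
Proof.
rewrite /input/= /first_action addn0; congr (@pi 1%N).
exact: val_inj.
Qed.

End measurable_closed_loop.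

(** * Laws of the scalar noises *)

Section noise_model_laws.
Context {R : realType} {n p m : nat} {D : plant R n p m}.
Context {T k : nat} {xhat : 'cV[R]_n} {Sigma : 'M[R]_n}.
Context {d : measure_display} {Om : measurableType d} {P : probability Om R}.
Variable N : noise_model D T k xhat Sigma P.

Lemma gaussian_entry (q : nat) (X : {RV P >-> 'cV[R]_q}) mu S i :
  is_gaussian X mu S ->
  has_normal_law P (fun om => X om i 0) (mu i 0) (S i i).
Proof.
move=> XG A mA; pose a : 'cV[R]_q := delta_mx i 0.
have e (x : 'cV[R]_q) : (a^T *m x) 0 0 = x i 0.
  by rewrite /a trmx_delta -rowE mxE.
have := XG a A mA.
have -> : qform S a = S i i by rewrite /qform /a trmx_delta -rowE -colE !mxE.
rewrite e => <-.
by congr (P _); apply/funext => om /=; rewrite e.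
Qed.

(** With covariance 0 every entry of the process noise has a point mass at 0 as
    its law, and countably many null sets have a null union. *)
Lemma wnoise_ae0 : covw D = 0 ->
  \forall om \ae P, forall t, (k <= t < T)%N -> wnoise N t om = 0.
Proof.
move=> Dw; apply: ae_foralln => t.
have [ktT|ktT] := boolP (k <= t < T)%N; last first.
  by apply: nearW => om.
have : \forall om \ae P, forall i (hi : (i < n)%N), wnoise N t om (Ordinal hi) 0 = 0.
  apply: ae_foralln => i; have [ni|ni] := pselect (i < n)%N; last first.
    by apply: nearW => om hi.
  have m0 : measurable (~` [set (0 : R)]) by exact: measurableC.
  have := gaussian_entry (Ordinal ni) (wnoise_gaussian N ktT) m0.
  rewrite Dw !mxE /normal_law eqxx diracE memNset => [PN|]; last by apply.
  exists ((fun om => wnoise N t om (Ordinal ni) 0) @^-1` (~` [set 0])); split => //.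
    have : measurable_fun setT (fun om => wnoise N t om (Ordinal ni) 0).
      exact: measurable_entry.
    by move=> /(_ measurableT _ m0); rewrite setTI.
  by move=> om /= H W0; apply: H => hi; rewrite (bool_irrelevance hi ni).
apply: filterS => om H _; apply/matrixP => i j.
by rewrite (ord1 j) mxE; case: i => i hi; exact: H.
Qed.

Lemma init_znoise_indep (i : 'I_n) (l : 'I_m) (S S' : set R) :
  (k < T)%N -> measurable S -> measurable S' ->
  let c om := init N om i 0 in let z om := znoise N k om l 0 in
  (P (c @^-1` S `&` z @^-1` S') = P (c @^-1` S) * P (z @^-1` S'))%E.
Proof.
move=> kT mS mS' c z.
pose E : set 'cV[R]_n := (fun x => x i 0) @^-1` S.
pose G t : set 'cV[R]_m := if t == k then (fun x => x l 0) @^-1` S' else setT.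
have mE : measurable E.
  have : measurable_fun setT (fun x : 'cV[R]_n => x i 0) by exact: measurable_entry.
  by move=> /(_ measurableT _ mS); rewrite setTI.
have mG t : measurable (G t).
  rewrite /G; case: eqP => _; last exact: measurableT.
  have : measurable_fun setT (fun x : 'cV[R]_m => x l 0) by exact: measurable_entry.
  by move=> /(_ measurableT _ mS'); rewrite setTI.
have := noise_independent N mE (fun=> measurableT) mG.
rewrite (big_ltn kT) big_nat_cond big1; last first.
  move=> t /andP[/andP[kt _] _].
  by rewrite /G gtn_eqF// !preimage_setT probability_setT mule1.
rewrite mule1 preimage_setT probability_setT mul1e {2}/G eqxx.
move=> <-; congr (P (_ `&` _)); apply/seteqP; split => om /=.
  by move=> Sz t _; split => //; rewrite /G; case: eqP => [->|].
by move=> /(_ k); rewrite /= leqnn kT /G eqxx => /(_ erefl) [].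
Qed.

End noise_model_laws.

(** * The plant *)

Definition i0 : 'I_3 := @Ordinal 3 0 isT.
Definition i1 : 'I_3 := @Ordinal 3 1 isT.
Definition i2 : 'I_3 := @Ordinal 3 2 isT.

Lemma sum_I3 (V : nmodType) (F : 'I_3 -> V) : \sum_i F i = F i0 + F i1 + F i2.
Proof.
rewrite !big_ord_recr big_ord0/= add0r; congr (F _ + F _ + F _); exact: val_inj.
Qed.

Section sensing_plant.
Context {R : realType}.

(** The state matrix is the nilpotent shift, so an initial state is forgotten
    after three steps and influences an observation-based decision only once. *)
Definition sensing_plant : plant R 3 1 1 := {|
  dynA := \matrix_(i, j) (i.+1 == j :> nat)%:R;
  dynB := delta_mx i0 0;
  obsC0 := 0;
  obsC := fun=> delta_mx 0 i2;
  costQT := 1%:M;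
  costQ := 1%:M;
  costR := 1%:M;
  covw := 0;
  covz := 1%:M |}.
Local Notation D := sensing_plant.

Lemma qform1 q (x : 'cV[R]_q) : qform 1%:M x = \sum_i x i 0 ^+ 2.
Proof.
by rewrite /qform mulmx1 mxE; apply: eq_bigr => i _; rewrite mxE expr2.
Qed.

Lemma posdef1 q : posdef (1%:M : 'M[R]_q).
Proof.
split=> [|v v0]; first by rewrite trmx1.
rewrite qform1 lt_neqAle sumr_ge0 ?andbT => [|i _]; last exact: sqr_ge0.
apply: contra_neq v0 => /esym/eqP; rewrite psumr_eq0 => [|i _]; last exact: sqr_ge0.
move=> /allP v0; apply/matrixP => i j; rewrite (ord1 j) mxE.
by apply/eqP; rewrite -sqrf_eq0; exact: v0 (mem_index_enum i).
Qed.

Lemma sensing_plant_assumptions : standing_assumptions D.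
Proof.
split => /=; first by split; exact: posdef1.
- split=> [|v]; first by rewrite trmx0.
  by rewrite /qform mulmx0 mul0mx mxE.
- have [sym pos] := posdef1 1; split=> // v.
  by have [->|/pos/ltW//] := eqVneq v 0; rewrite /qform mulmx0 mxE.
- exact: unitmx1.
Qed.

Section loop.
Context {T k : nat} {xhat : 'cV[R]_3} {Sigma : 'M[R]_3}.
Context {d : measure_display} {Om : measurableType d} {P : probability Om R}.
Variables (N : noise_model D T k xhat Sigma P).
Variable pi : policy (R := R) (p := 1) (m := 1).
Local Notation x om := (init N om).
Local Notation X := (state N pi).
Local Notation u j om := (input N pi om j 0 0).
Local Notation v := (first_action pi 0 0).

Lemma sensing_observation (w : 'cV[R]_1) (y : 'cV[R]_3) :
  (obs_matrix D w *m y) = const_mx (w 0 0 * y i2 0).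
Proof.
apply/matrixP => i j; rewrite !(ord1 i) (ord1 j) /obs_matrix big_ord1 /= add0r.
by rewrite -scalemxAl -rowE !mxE.
Qed.

Lemma sensing_step (om : Om) j : wnoise N (k + j) om = 0 ->
  [/\ X om j.+1 i0 0 = X om j i1 0 + u j om,
      X om j.+1 i1 0 = X om j i2 0 & X om j.+1 i2 0 = 0].
Proof.
move=> w0; rewrite !stateS w0 addr0.
split; rewrite !mxE sum_I3 big_ord1 !mxE/=.
  by rewrite !mul0r mul1r add0r addr0 mul1r.
all: by rewrite ?mul0r ?mul1r ?add0r ?addr0.
Qed.

(** Counting the state one step late pairs each input with the state that it
    controls. *)
Definition stage_cost om j :=
  qform (costQ D) (X om j.+1) + qform (costR D) (input N pi om j).

Lemma cost_by_stages om (n : nat) :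
  qform (costQT D) (X om n) +
    \sum_(j < n) (qform (costQ D) (X om j) + qform (costR D) (input N pi om j)) =
  qform 1%:M (x om) + \sum_(j < n) stage_cost om j.
Proof.
rewrite /stage_cost !big_split/= !addrA; congr (_ + _).
rewrite addrC -(big_ord_recr n (fun j => qform 1%:M (X om j))).
by rewrite big_ord_recl.
Qed.

Section noiseless.
Variable om : Om.
Hypothesis w0 : forall t, (k <= t < T)%N -> wnoise N t om = 0.

Let w0' j : (j < T - k)%N -> wnoise N (k + j) om = 0.
Proof. by move=> jT; apply: w0; rewrite leq_addr/= -ltn_subRL. Qed.

Lemma stage_costE j : (j < T - k)%N ->
  stage_cost om j = (X om j i1 0 + u j om) ^+ 2 + X om j i2 0 ^+ 2 + u j om ^+ 2.
Proof.
move=> jT; have [e0 e1 e2] := sensing_step (w0' jT).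
by rewrite /stage_cost !qform1 sum_I3 big_ord1 e0 e1 e2 expr0n addr0.
Qed.

Lemma stage_cost0E : (0 < T - k)%N ->
  stage_cost om 0 = (x om i1 0 + v) ^+ 2 + x om i2 0 ^+ 2 + v ^+ 2.
Proof. by move=> T0; rewrite stage_costE. Qed.

Lemma stage_cost1E : (1 < T - k)%N ->
  stage_cost om 1 = (x om i2 0 + u 1 om) ^+ 2 + u 1 om ^+ 2.
Proof.
move=> T1; rewrite stage_costE//.
have [_ -> ->] := sensing_step (w0' (ltnW T1)).
by rewrite expr0n addr0.
Qed.

Lemma stage_cost_geE j : (j.+2 < T - k)%N ->
  stage_cost om j.+2 = u j.+2 om ^+ 2 + u j.+2 om ^+ 2.
Proof.
move=> jT; rewrite stage_costE//.
have [_ -> ->] := sensing_step (w0' (ltnW jT)).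
have [_ _ ->] := sensing_step (w0' (ltnW (ltnW jT))).
by rewrite expr0n addr0 add0r.
Qed.

End noiseless.

(** The first action is a constant and the output a scalar, so this real function
    is all that a policy can choose at its second step. *)
Definition second_input (y : R) : R :=
  @pi 1%N [tuple (first_action pi, const_mx y)] 0 0.

Lemma input1E om : u 1 om = second_input (v * x om i2 0 + znoise N k om 0 0).
Proof.
rewrite input1 sensing_observation /second_input; congr (@pi 1%N _ 0 0).
apply/val_inj => /=; congr [:: (_, _)]; apply/matrixP => i j.
by rewrite (ord1 i) (ord1 j) !mxE.
Qed.

Lemma measurable_second_input : admissible pi -> measurable_fun setT second_input.
Proof.
move=> adm.
have mt : measurable_fun [set: R] (fun y : R =>
    [tuple (first_action pi, const_mx y : 'cV[R]_1)]).
  apply/measurable_fun_tnthP => i.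
  rewrite (_ : _ \o _ = fun y => (first_action pi, const_mx y : 'cV[R]_1)).
    apply: measurable_fun_pair => //; apply: measurable_mx => a b.
    by rewrite (_ : (fun _ => _) = id)//; apply/funext => y; rewrite mxE.
  by apply/funext => y /=; rewrite (ord1 i).
have mp := measurableT_comp (@adm 1%N) mt.
exact: measurable_entry mp.
Qed.

End loop.
End sensing_plant.

(** * The expected cost of a policy *)

Lemma posdef_diag_gt0 (R : realType) n (M : 'M[R]_n) i : posdef M -> 0 < M i i.
Proof.
move=> [_ /(_ (delta_mx i 0))]; rewrite /qform trmx_delta -rowE -colE !mxE; apply.
apply/eqP => /matrixP/(_ i 0); rewrite !mxE !eqxx => /eqP.
by rewrite oner_eq0.
Qed.

Section expected_cost.
Context {R : realType}.
Local Notation D := (sensing_plant (R := R)).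

(** The least expected cost over n steps when the first action is v.  The
    correction term is absent for n = 1, when no decision follows the first
    observation. *)
Definition sensing_cost (n : nat) (xhat : 'cV[R]_3) (Sigma : 'M[R]_3) (v : R) : R :=
  \sum_i (xhat i 0 ^+ 2 + Sigma i i * std_normal_var) +
  ((xhat i1 0 + v) ^+ 2 + Sigma i1 i1 * std_normal_var +
   (xhat i2 0 ^+ 2 + Sigma i2 i2 * std_normal_var) + v ^+ 2) +
  (if (1 < n)%N then min_correction_cost (xhat i2 0) (Sigma i2 i2) v else 0).

Section loop.
Context {T k : nat} {xhat : 'cV[R]_3} {Sigma : 'M[R]_3}.
Context {d : measure_display} {Om : measurableType d} {P : probability Om R}.
Variables (N : noise_model D T k xhat Sigma P).
Variable pi : policy (R := R) (p := 1) (m := 1).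
Hypotheses (Sp : posdef Sigma) (kT : (k < T)%N) (adm : admissible pi).
Local Notation x om := (init N om).
Local Notation v := (first_action pi 0 0).
Local Notation f := (second_input pi).

Let y om := v * x om i2 0 + znoise N k om 0 0.

Let first_cost om := \sum_i x om i 0 ^+ 2 +
  ((x om i1 0 + v) ^+ 2 + x om i2 0 ^+ 2 + v ^+ 2).

Let second_cost om :=
  if (1 < T - k)%N then (x om i2 0 + f (y om)) ^+ 2 + f (y om) ^+ 2 else 0.

Let total_cost om := qform (costQT D) (state N pi om (T - k)) +
    \sum_(j < T - k) (qform (costQ D) (state N pi om j) +
                      qform (costR D) (input N pi om j)).

Let later_cost om :=
  \sum_(2 <= j < T - k) (input N pi om j 0 0 ^+ 2 + input N pi om j 0 0 ^+ 2).

Let total_costE om : (forall t, (k <= t < T)%N -> wnoise N t om = 0) ->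
  total_cost om = first_cost om + second_cost om + later_cost om.
Proof.
move=> w0; rewrite /total_cost cost_by_stages qform1 /first_cost -!addrA.
congr (_ + _).
have T0 : (0 < T - k)%N by rewrite subn_gt0.
rewrite -(big_mkord xpredT (stage_cost N pi om)) (big_ltn T0) stage_cost0E//.
rewrite -!addrA; do 3 congr (_ + _).
rewrite /second_cost /later_cost; case: ltnP => T1; last first.
  by rewrite !big_geq ?addr0// leqW.
rewrite (big_ltn T1) stage_cost1E// input1E -!addrA; do 2 congr (_ + _).
rewrite big_nat_cond [RHS]big_nat_cond; apply: eq_bigr.
by move=> [|[|j]]//= /andP[jT _]; rewrite stage_cost_geE.
Qed.

Let mxi i : measurable_fun setT (fun om => x om i 0).
Proof. exact: measurable_entry. Qed.

Let mz : measurable_fun setT (fun om => znoise N k om 0 0).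
Proof. exact: measurable_entry. Qed.

Let my : measurable_fun setT y.
Proof. by apply: measurable_funD => //; exact: measurable_funM. Qed.

Let mfy : measurable_fun setT (fun om => f (y om)).
Proof. by have mf := measurable_second_input adm; exact: measurableT_comp mf my. Qed.

Let mfirst : measurable_fun setT first_cost.
Proof.
apply: measurable_funD; first by apply: measurable_sum => i; exact: measurable_funX.
apply: measurable_funD => //; apply: measurable_funD; apply: measurable_funX => //.
exact: measurable_funD.
Qed.

Let msecond : measurable_fun setT second_cost.
Proof.
rewrite /second_cost; case: ltnP => // _.
by apply: measurable_funD; apply: measurable_funX => //; exact: measurable_funD.
Qed.

Let mtotal : measurable_fun setT total_cost.
Proof.
apply: measurable_funD.
  by apply: measurable_qform; exact: measurable_state.
apply: measurable_sum => j; apply: measurable_funD; apply: measurable_qform.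
  exact: measurable_state.
exact: measurable_input.
Qed.

Let first_ge0 om : 0 <= first_cost om.
Proof. by rewrite !addr_ge0 ?sqr_ge0// sumr_ge0// => i _; rewrite sqr_ge0. Qed.

Let second_ge0 om : 0 <= second_cost om.
Proof. by rewrite /second_cost; case: ifP => // _; rewrite addr_ge0 ?sqr_ge0. Qed.

Let total_ge0 om : 0 <= total_cost om.
Proof.
have q0 q (w : 'cV[R]_q) : 0 <= qform 1%:M w.
  by rewrite qform1; apply: sumr_ge0 => i _; exact: sqr_ge0.
by apply: addr_ge0 => //; apply: sumr_ge0 => j _; exact: addr_ge0.
Qed.

Local Open Scope ereal_scope.

Let integralD_ge0 (g h : Om -> R) : measurable_fun setT g -> measurable_fun setT h ->
  (forall om, 0 <= g om)%R -> (forall om, 0 <= h om)%R ->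
  \int[P]_om (g om + h om)%:E = \int[P]_om (g om)%:E + \int[P]_om (h om)%:E.
Proof.
move=> mg mh g0 h0; under eq_integral do rewrite EFinD.
rewrite ge0_integralD//;
  try by [move=> om _; rewrite lee_fin | exact/measurable_EFinP].
Qed.

Let integral_entry_sqr i t :
  \int[P]_om ((x om i 0 + t) ^+ 2)%R%:E =
  ((xhat i 0 + t) ^+ 2 + Sigma i i * std_normal_var)%R%:E.
Proof.
apply: integral_sqr_normal_law => //; first exact: posdef_diag_gt0.
exact: gaussian_entry (init_gaussian N).
Qed.

Let integral_first : \int[P]_om (first_cost om)%:E =
  (\sum_i (xhat i 0 ^+ 2 + Sigma i i * std_normal_var) +
  ((xhat i1 0 + v) ^+ 2 + Sigma i1 i1 * std_normal_var +
   (xhat i2 0 ^+ 2 + Sigma i2 i2 * std_normal_var) + v ^+ 2))%R%:E.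
Proof.
have sq i : \int[P]_om (x om i 0 ^+ 2)%R%:E =
    (xhat i 0 ^+ 2 + Sigma i i * std_normal_var)%R%:E.
  have := integral_entry_sqr i 0; rewrite addr0 => <-.
  by apply: eq_integral => om _; rewrite addr0.
have m2 i : measurable_fun setT (fun om => x om i 0 ^+ 2)%R.
  exact: measurable_funX.
have mv : measurable_fun setT (fun om => (x om i1 0 + v) ^+ 2)%R.
  by apply: measurable_funX; exact: measurable_funD.
have s0 (r : R) : (0 <= r ^+ 2)%R by exact: sqr_ge0.
have ms : measurable_fun setT (fun om => \sum_i x om i 0 ^+ 2)%R.
  exact: measurable_sum.
have mr : measurable_fun setT (fun om => (x om i1 0 + v) ^+ 2 + x om i2 0 ^+ 2)%R.
  exact: measurable_funD.
rewrite /first_cost integralD_ge0//; last 3 first.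
- exact: measurable_funD.
- by move=> om; apply: sumr_ge0.
- by move=> om; rewrite !addr_ge0.
rewrite EFinD; congr (_ + _).
  under eq_integral do rewrite sum_I3.
  rewrite sum_I3 !integralD_ge0//.
  - by rewrite !sq -!EFinD.
  - exact: measurable_funD.
  - by move=> om; rewrite addr_ge0.
rewrite integralD_ge0//; last by move=> om; rewrite addr_ge0.
rewrite integralD_ge0// integral_entry_sqr sq integral_cst//=.
by rewrite probability_setT mule1 -!EFinD.
Qed.

Let x2_law : has_normal_law P (fun om => x om i2 0%R) (xhat i2 0%R) (Sigma i2 i2).
Proof. exact: gaussian_entry (init_gaussian N). Qed.

Let z_law : has_normal_law P (fun om => znoise N k om 0%R 0%R) 0 1.
Proof.
have kkT : (k <= k < T)%N by rewrite leqnn.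
by have := gaussian_entry 0%R (znoise_gaussian N kkT); rewrite !mxE eqxx.
Qed.

Let integral_first_second : \int[P]_om (first_cost om + second_cost om)%:E =
  \int[P]_om (first_cost om)%:E + \int[P]_om (second_cost om)%:E.
Proof. exact: integralD_ge0. Qed.

Let ae_total_cost : \forall om \ae P, 
  total_cost om = (first_cost om + second_cost om + later_cost om)%R.
Proof. by have := wnoise_ae0 N erefl; apply: filterS => om; exact: total_costE. Qed.

(** Almost surely the cost splits into a part fixed by the first action, the cost
    of the correction of c, and the nonnegative cost of all later inputs. *)
Lemma expected_cost_ge :
  (sensing_cost (T - k) xhat Sigma v)%:E <= expected_cost N pi.
Proof.
apply: (@le_trans _ _ (\int[P]_om (first_cost om + second_cost om)%:E)).
  rewrite integral_first_second integral_first /sensing_cost [leLHS]EFinD leeD2l//.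
  rewrite /second_cost; case: ltnP => T1; last by rewrite integral0.
  apply: min_correction_cost_le => //; [exact: posdef_diag_gt0 | |].
    by move=> S S'; exact: init_znoise_indep.
  exact: measurable_second_input.
apply: ae_ge0_le_integral => //.
- by move=> om _; rewrite lee_fin addr_ge0.
- by apply/measurable_EFinP; exact: measurable_funD.
- by move=> om _; rewrite lee_fin total_ge0.
- by apply/measurable_EFinP; exact: mtotal.
have := ae_total_cost; apply: filterS => om e _.
rewrite lee_fin -/(total_cost om) e lerDl.
by apply: sumr_ge0 => j _; rewrite addr_ge0 ?sqr_ge0.
Qed.

Lemma expected_cost_eq :
  (forall y,
    f y = - posterior_mean (xhat i2 0) (Num.sqrt (Sigma i2 i2)) v y / 2)%R ->
  (forall j (h : history j), (1 < j)%N -> pi h = 0%R) ->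
  expected_cost N pi = (sensing_cost (T - k) xhat Sigma v)%:E.
Proof.
move=> fE pi0.
transitivity (\int[P]_om (first_cost om + second_cost om)%:E).
  apply: ae_eq_integral => //.
  - by apply/measurable_EFinP; exact: mtotal.
  - by apply/measurable_EFinP; exact: measurable_funD.
  have := ae_total_cost; apply: filterS => om e _; rewrite -/(total_cost om) e.
  rewrite /later_cost big_nat_cond big1 ?addr0// => j /andP[/andP[j1 _] _].
  by rewrite /input pi0// mxE expr0n addr0.
rewrite integral_first_second integral_first /sensing_cost [RHS]EFinD; congr (_ + _).
rewrite /second_cost; case: ltnP => T1; last by rewrite integral0.
under eq_integral do rewrite fE.
apply: min_correction_cost_eq => //; first exact: posdef_diag_gt0.
by move=> S S'; exact: init_znoise_indep.
Qed.

End loop.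
End expected_cost.

(** * The trade-off that determines the first action *)

Section first_action_cost.
Context {R : realType}.
Implicit Types h K s v w : R.

(** The first two terms are the cost of acting, the last is the residual
    uncertainty about the third state; K is zero when a measurement has no use. *)
Definition action_cost h K s v : R := 2 * v ^+ 2 + 2 * h * v + K / (s * v ^+ 2 + 1).

Let den_gt0 s v : 0 <= s -> 0 < s * v ^+ 2 + 1.
Proof. by move=> s0; rewrite ltr_wpDl// mulr_ge0// sqr_ge0. Qed.

Let is_derive_action_cost h K s v : 0 <= s ->
  is_derive v 1 (action_cost h K s)
    (4 * v + 2 * h - K * (2 * s * v) / (s * v ^+ 2 + 1) ^+ 2).
Proof.
move=> s0; have d0 : s * v ^+ 2 + 1 != 0 by rewrite gt_eqF// den_gt0.
pose q w := s * w ^+ 2 + 1.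
have dq : is_derive v 1 q (2 * s * v).
  apply: is_derive_eq; rewrite /GRing.scale/=; ring.
have dV : is_derive v 1 (fun w => (q w)^-1) (- (q v) ^- 2 *: (2 * s * v)).
  exact: is_deriveV.
have dp : is_derive v 1 (fun w => 2 * w ^+ 2 + 2 * h * w) (4 * v + 2 * h).
  by apply: is_derive_eq; rewrite /GRing.scale/=; ring.
have := is_deriveD dp (is_deriveZ K dV).
have -> : (fun w => 2 * w ^+ 2 + 2 * h * w) + K \*: (fun w => (q w)^-1) =
    action_cost h K s by apply/funext => w.
congr (is_derive _ _ _ _); rewrite /GRing.scale/= -/(q v).
by field; rewrite d0.
Qed.

(** Outside [- M, M] the quadratic part alone exceeds the value K at 0, so the
    minimum over this segment is global. *)
Lemma ex_min_action_cost h K s : 0 <= K -> 0 <= s ->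
  exists v, forall w, action_cost h K s v <= action_cost h K s w.
Proof.
move=> K0 s0; pose M := `|h| + K + 1.
have M0 : 0 <= M by rewrite !addr_ge0.
have MM : - M <= M by rewrite ge0_cp.
have cf : {within `[- M, M], continuous (action_cost h K s)}.
  apply: continuous_subspaceT => v.
  apply: differentiable_continuous; apply/derivable1_diffP.
  by have [] := is_derive_action_cost h K v s0.
have [v vM vmin] := EVT_min MM cf.
exists v => w; have [wM|wM] := boolP (w \in `[- M, M]); first exact: vmin.
have h0 : 0 \in `[- M, M] by rewrite in_itv/= oppr_le0 M0.
apply: le_trans (vmin 0 h0) _.
have {}wM : M < `|w|.
  by rewrite ltNge; apply: contra wM; rewrite in_itv/= ler_norml.
rewrite /action_cost !expr0n/= !mulr0 !add0r divr1.
have : 0 <= K / (s * w ^+ 2 + 1) by rewrite divr_ge0// ltW// den_gt0.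
have : - (2 * h * w) <= 2 * `|h| * `|w|.
  by rewrite -mulrA -mulrN -[leRHS]mulrA ler_pM2l// -normrM -normrN ler_norm.
have -> : w ^+ 2 = `|w| ^+ 2 by rewrite real_normK// num_real.
have := normr_ge0 h; move: wM; rewrite /M.
move: (`|h|) (`|w|) (_ / _) => H W q; nra.
Qed.

Lemma min_action_cost_stationary h K s v : 0 <= s ->
  (forall w, action_cost h K s v <= action_cost h K s w) ->
  4 * v + 2 * h = K * (2 * s * v) / (s * v ^+ 2 + 1) ^+ 2.
Proof.
move=> s0 vmin.
have D := is_derive_action_cost h K v s0.
have vv : v \in `](v - 1), (v + 1)[ by rewrite in_itv/= ltrBlDr !ltrDl ltr01.
have D0 : is_derive v 1 (action_cost h K s) 0.
  have ab : v - 1 <= v + 1 by rewrite lerD2l -subr_ge0 opprK.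
  have df w : w \in `](v - 1), (v + 1)[ -> derivable (action_cost h K s) w 1.
    by move=> _; have [] := is_derive_action_cost h K w s0.
  exact: (derive1_at_min ab df vv (fun w _ => vmin w)).
apply/eqP; rewrite -subr_eq0; apply/eqP.
by have [_ <-] := D; have [_ ->] := D0.
Qed.

(** If a = 0 the left side varies with h and the right side does not.  Otherwise v
    takes every real value, and the left side is affine in v while the right side is
    not: its values at 0, 1, 2 are 0, K / 2, 4 K / 25. *)
Lemma stationary_not_affine K : 0 < K ->
  ~ exists a b : R, forall h, let v := a * h + b in
      4 * v + 2 * h = K * (2 * 1 * v) / (1 * v ^+ 2 + 1) ^+ 2.
Proof.
move=> K0 [a [b H]].
have [a0|a0] := eqVneq a 0.
  have := H 0; have := H 1; rewrite a0 /= !mul0r !add0r; lra.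
have Hv v : 4 * v + 2 * ((v - b) / a) = K * (2 * v) / (v ^+ 2 + 1) ^+ 2.
  have := H ((v - b) / a); have -> : a * ((v - b) / a) + b = v by field.
  by rewrite /= mulr1 mul1r.
have e0 : K * (2 * 0) / (0 ^+ 2 + 1) ^+ 2 = 0 by field.
have e1 : K * (2 * 1) / (1 ^+ 2 + 1) ^+ 2 = K / 2 by field.
have e2 : K * (2 * 2) / (2 ^+ 2 + 1) ^+ 2 = K * (4 / 25) by field.
have := Hv 0; have := Hv 1; have := Hv 2; rewrite e0 e1 e2.
by move: (a^-1) => c; lra.
Qed.

End first_action_cost.

(** * Optimal policies *)

Section sensing_optimum.
Context {R : realType}.
Local Notation D := (sensing_plant (R := R)).
Implicit Types (xhat : 'cV[R]_3) (Sigma : 'M[R]_3) (v w : R).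

(** The constant K of [action_cost]: information has value only if a decision is
    left after the first observation. *)
Definition information_weight (n : nat) Sigma : R :=
  if (1 < n)%N then std_normal_var * Sigma i2 i2 / 2 else 0.

Lemma sensing_costE n xhat Sigma : exists C : R, forall v,
  sensing_cost n xhat Sigma v =
  C + action_cost (xhat i1 0) (information_weight n Sigma) (Sigma i2 i2) v.
Proof.
exists (\sum_i (xhat i 0 ^+ 2 + Sigma i i * std_normal_var) +
  (xhat i1 0 ^+ 2 + Sigma i1 i1 * std_normal_var +
   (xhat i2 0 ^+ 2 + Sigma i2 i2 * std_normal_var)) +
  (if (1 < n)%N then (xhat i2 0 ^+ 2 + Sigma i2 i2 * std_normal_var) / 2 else 0)).
move=> v; rewrite /sensing_cost /information_weight /action_cost.
case: ifP => _; last by ring.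
rewrite /min_correction_cost; move: (_^-1) => r; by ring.
Qed.

(** Optimal among the policies with first action v: the second input is the best
    correction of the third state, and later inputs have nothing left to correct. *)
Definition sensing_policy (mean var v : R) : policy (R := R) (p := 1) (m := 1) :=
  fun j => match j return history j -> 'cV[R]_1 with
  | 0 => fun=> const_mx v
  | 1 => fun h =>
      const_mx (- posterior_mean mean (Num.sqrt var) v ((thead h).2 0 0) / 2)
  | _ => fun=> 0
  end.

Lemma sensing_policy_admissible mean var v : admissible (sensing_policy mean var v).
Proof.
case=> [|[|j]] //=; apply: measurable_mx => i j.
have mh : measurable_fun setT
    (fun h : history (R := R) (p := 1) (m := 1) 1 => (thead h).2 0 0).
  apply: (measurable_entry (f := fun h => (thead h).2)).
  have mt := @measurable_tnth _ ('cV[R]_1 * 'cV[R]_1)%type 1 ord0.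
  exact: measurableT_comp measurable_snd mt.
rewrite (_ : (fun _ => _) = fun h : history 1 =>
  - posterior_mean mean (Num.sqrt var) v ((thead h).2 0 0) / 2); last first.
  by apply/funext => h; rewrite mxE.
apply: measurable_funM => //; apply: measurable_funN.
exact: measurableT_comp (measurable_posterior_mean _ _ _) mh.
Qed.

Section law.
Context {T k : nat} {xhat : 'cV[R]_3} {Sigma : 'M[R]_3}.
Hypotheses (Sp : posdef Sigma) (kT : (k < T)%N).
Local Notation J := (sensing_cost (T - k) xhat Sigma).

Lemma expected_cost_sensing_policy (d : measure_display) (Om : measurableType d)
    (P : probability Om R) (N : noise_model D T k xhat Sigma P) v :
  expected_cost N (sensing_policy (xhat i2 0) (Sigma i2 i2) v) = (J v)%:E.
Proof.
have adm := sensing_policy_admissible (xhat i2 0) (Sigma i2 i2) v.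
rewrite (expected_cost_eq N Sp kT adm); first by rewrite /first_action mxE.
  by move=> y; rewrite /second_input /first_action /= !mxE.
by move=> [|[|j]].
Qed.

Lemma sensing_policy_optimal v : (forall w, J v <= J w) ->
  optimal_policy D T k xhat Sigma (sensing_policy (xhat i2 0) (Sigma i2 i2) v).
Proof.
move=> vmin; split=> [|d Om P N pi' adm']; first exact: sensing_policy_admissible.
rewrite expected_cost_sensing_policy.
apply: le_trans (expected_cost_ge N Sp kT adm').
by rewrite lee_fin.
Qed.

End law.

(** Compares a given optimal policy with [sensing_policy] for every w, in a noise
    model that exists by [ex_noise_model]. *)
Lemma optimal_first_action_min T k xhat pi : (k < T)%N ->
  optimal_policy D T k xhat 1%:M pi ->
  forall w, sensing_cost (T - k) xhat 1%:M (first_action pi 0 0) <=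
            sensing_cost (T - k) xhat 1%:M w.
Proof.
move=> kT [adm opt] w.
have [d [Om [P [N]]]] := @ex_noise_model R 3 1 D T k xhat erefl erefl (ltnW kT).
rewrite -lee_fin -(expected_cost_sensing_policy (posdef1 3) kT N w).
apply: le_trans (expected_cost_ge N (posdef1 3) kT adm) _.
by apply: opt; exact: sensing_policy_admissible.
Qed.

Lemma sensing_has_optimal_policies T : has_optimal_policies D T.
Proof.
move=> k xhat Sigma kT Sp.
have [C JE] := sensing_costE (T - k) xhat Sigma.
have s0 := posdef_diag_gt0 i2 Sp.
have K0 : 0 <= information_weight (T - k) Sigma.
  rewrite /information_weight; case: ifP => // _.
  by rewrite divr_ge0// mulr_ge0// ltW// std_normal_var_gt0.
have [v vmin] := ex_min_action_cost (xhat i1 0) K0 (ltW s0).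
exists (sensing_policy (xhat i2 0) (Sigma i2 i2) v).
by apply: sensing_policy_optimal => // w; rewrite !JE lerD2l.
Qed.

(** With the identity prior covariance and estimates h e_2, an affine optimal first
    action would be an affine function of h, against [stationary_not_affine]. *)
Lemma sensing_not_affine T k : (k.+1 < T)%N -> ~ affine_in_estimate D T k.
Proof.
move=> kT /(_ 1%:M (posdef1 3)) [L [b aff]].
pose K : R := information_weight (T - k) 1%:M.
have K0 : 0 < K.
  rewrite /K /information_weight ltn_subRL addn1 kT mxE eqxx mulr1.
  by rewrite divr_gt0// std_normal_var_gt0.
apply: (stationary_not_affine K0); exists (L 0 i1), (b 0 0) => h v.
pose xhat : 'cV[R]_3 := h *: delta_mx i1 0.
have [pi opt piE] := aff xhat.
have := optimal_first_action_min (ltnW kT) opt.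
have -> : first_action pi 0 0 = v.
  by rewrite piE /xhat -scalemxAr -colE !mxE mulrC.
have [C JE] := sensing_costE (T - k) xhat 1%:M.
move=> vmin; have := @min_action_cost_stationary R h K 1 v ler01; apply => w.
have := vmin w; rewrite !JE lerD2l.
by rewrite /xhat !mxE !eqxx mulr1.
Qed.

End sensing_optimum.

Theorem theorem1 (R : realType) (T k : nat) (hT : (2 <= T)%N)
    (hk : (k <= T - 2)%N) :
  exists (n p m : nat) (D : plant R n p m),
    [/\ [/\ (0 < n)%N, (0 < p)%N & (0 < m)%N],
        standing_assumptions D,
        has_optimal_policies D T
      & ~ affine_in_estimate D T k].
Proof.
exists 3, 1, 1, sensing_plant; split => //.
- exact: sensing_plant_assumptions.
- exact: sensing_has_optimal_policies.
- by apply: sensing_not_affine; move: hk; rewrite leq_subRL.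
Qed.
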